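(* Let $T$ be a complete NTP$_{2}$ theory. Then $T$ is NTP$_{2}$-distal if and only if the following holds: whenever $I$ is an indiscernible sequence indexed by a dense linear order, written as $I=I_{1}+I_{2}$ where $I_{1}$ has no last element and $I_{2}$ has no first element, $d$ is a tuple such that $I$ is indiscernible over $d$, $b$ is a tuple such that $I_{1}+\langle b\rangle+I_{2}$ is indiscernible, and $\varphi(x,d)$ is a formula that divides over $I$, then $\neg\varphi(b,d)$ holds.
   Context: $\mathfrak{C}$ is the monster model of $T$. A Keisler measure over a set $A$ in variable $x$ is a finitely additive probability measure on the Boolean algebra $L_x(A)$ of formulas in $x$ with parameters from $A$. A formula $\varphi(x,b)$ divides over $A$ if there is an $A$-indiscernible sequence $\langle b_i:i<\omega\rangle$ with $b_0=b$ such that $\{\varphi(x,b_i):i<\omega\}$ is inconsistent. A Keisler measure $\mu$ over $A$ is NTP$_{2}$-smooth if for every set $B\supseteq A$ and every Keisler measure $\mu'$ over $B$ extending $\mu$, every formula $\varphi(x,b)\in L_x(B)$ which divides over $A$ has $\mu'(\varphi(x,b))=0$. For an indiscernible sequence $I=\langle a_i : i\in[0,1]\rangle$ (with $a_i$ of the length of $x$) and a formula $D(x)$ with parameters from $I$, the set $D_I=\{i\in[0,1] : \models D(a_i)\}$ is a finite union of intervals; $\mathrm{Av}_I|_I$ denotes the Keisler measure over $I$ given by $\mathrm{Av}_I|_I(D)=\lambda(D_I)$, where $\lambda$ is Lebesgue measure on $[0,1]$. $T$ is NTP$_{2}$ if no formula $\varphi(x,y)$ has TP$_{2}$, i.e.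 there are no array $\langle a_{i,j}:i,j<\omega\rangle$ and $k<\omega$ with every path $\{\varphi(x,a_{i,\eta(i)}):i<\omega\}$ ($\eta:\omega\to\omega$) consistent and every row $\{\varphi(x,a_{i,j}):j<\omega\}$ $k$-inconsistent. $T$ is NTP$_{2}$-distal if $T$ is NTP$_{2}$ and for every indiscernible sequence $I=\langle a_i:i\in[0,1]\rangle$, the measure $\mathrm{Av}_I|_I$ is NTP$_{2}$-smooth.
   Formalization: The two pieces I_1 and I_2 are required to be nonempty; with I_1 empty the criterion already fails in dense linear orders, which are NTP2-distal (take φ(x,d) to be x = d, with b = d below I_2). *)

(* Defs.v *)
From mathcomp Require Import all_boot all_order all_algebra.
From mathcomp Require Import all_classical all_reals all_analysis.

Set Implicit Arguments.
Unset Strict Implicit.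
Unset Printing Implicit Defensive.

Import Order.TTheory GRing.Theory Num.Theory.
Local Open Scope classical_set_scope.
Local Open Scope ring_scope.

(** * First-order logic *)

Record language : Type := Language {
  funsym : Type;
  relsym : Type;
  farity : funsym -> nat;
  rarity : relsym -> nat }.

(* Terms and formulas have their free variables in an arbitrary type [V]; a
   quantifier binds the variable [None] of [option V]. Taking [V] to be
   ['I_n + A] gives the formulas in [n] variables with parameters from [A]. *)
Inductive term (L : language) (V : Type) : Type :=
| Var of V
| App (f : funsym L) of ('I_(farity f) -> term L V).

Inductive formula (L : language) (V : Type) : Type :=
| Bot
| Eq of term L V & term L V
| Rel (r : relsym L) of ('I_(rarity r) -> term L V)
| Imp of formula L V & formula L V
| All of formula L (option V).

Arguments Var {L V}.
Arguments App {L V}.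
Arguments Bot {L V}.
Arguments Eq {L V}.
Arguments Rel {L V}.
Arguments Imp {L V}.
Arguments All {L V}.

Definition Not {L} {V : Type} (phi : formula L V) := Imp phi Bot.
Definition Top {L} {V : Type} : formula L V := Not Bot.
Definition Or {L} {V : Type} (phi psi : formula L V) := Imp (Not phi) psi.

Fixpoint term_map {L} {V W : Type} (g : V -> W) (t : term L V) : term L W :=
  match t with
  | Var v => Var (g v)
  | App f args => App f (fun i => term_map g (args i))
  end.

Fixpoint formula_map {L} {V W : Type} (g : V -> W) (phi : formula L V) :
    formula L W :=
  match phi with
  | Bot => Bot
  | Eq t u => Eq (term_map g t) (term_map g u)
  | Rel r args => Rel r (fun i => term_map g (args i))
  | Imp phi1 phi2 => Imp (formula_map g phi1) (formula_map g phi2)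
  | All psi => All (formula_map (omap g) psi)
  end.

Record structure (L : language) : Type := Structure {
  carrier :> Type;
  carrier_inhabited : inhabited carrier;
  fint : forall f : funsym L, ('I_(farity f) -> carrier) -> carrier;
  rint : forall r : relsym L, ('I_(rarity r) -> carrier) -> Prop }.

Arguments fint {L} s f _.
Arguments rint {L} s r _.

Fixpoint term_eval {L} {M : structure L} {V : Type} (t : term L V)
    (v : V -> M) : M :=
  match t with
  | Var x => v x
  | App f args => fint M f (fun i => term_eval (args i) v)
  end.

Fixpoint sat {L} {M : structure L} {V : Type} (phi : formula L V) :
    (V -> M) -> Prop :=
  match phi with
  | Bot => fun=> False
  | Eq t u => fun v => term_eval t v = term_eval u v
  | Rel r args => fun v => rint M r (fun i => term_eval (args i) v)
  | Imp phi1 phi2 => fun v => sat phi1 v -> sat phi2 v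
  | All psi => fun v => forall c : M, sat psi (oapp v c)
  end.

Definition sentence (L : language) := formula L void.
Definition theory (L : language) := set (sentence L).

Definition models {L} (M : structure L) (T : theory L) : Prop :=
  forall s : sentence L, T s -> sat s (of_void M).

Definition entails {L} (T : theory L) (s : sentence L) : Prop :=
  forall M : structure L, models M T -> sat s (of_void M).

Definition complete_theory {L} (T : theory L) : Prop :=
  (exists M : structure L, models M T) /\
  (forall s : sentence L, entails T s \/ entails T (Not s)).

(** * Tuples and formulas with parameters *)

Notation tup M n := ('I_n -> carrier M).

Definition vjoin {X Y Z : Type} (f : X -> Z) (g : Y -> Z) (v : X + Y) : Z :=
  match v with inl x => f x | inr y => g y end.

(* The formulas in [n] variables with parameters from [A]: [L_x(A)]. *)
Definition formula_over {L} {M : structure L} (n : nat) (A : set M) : Type :=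
  formula L ('I_n + A).

Definition holds {L} {M : structure L} {n} {A : set M}
    (phi : formula_over n A) (x : tup M n) : Prop :=
  sat phi (vjoin x val).

(* The formula [phi(x, b)] of [L_x(A)], for a tuple [b] from [A]. *)
Definition inst {L} {M : structure L} {n m} {A : set M}
    (phi : formula L ('I_n + 'I_m)) (b : 'I_m -> A) : formula_over n A :=
  formula_map (vjoin inl (inr \o b)) phi.

Definition param_incl {T : Type} {A B : set T} (AB : A `<=` B) (a : A) : B :=
  SigSub (mem_set (AB _ (set_valP a))).

Definition formula_incl {L} {M : structure L} {n} {A B : set M}
    (AB : A `<=` B) (phi : formula_over n A) : formula_over n B :=
  formula_map (vjoin inl (inr \o param_incl AB)) phi.

(** * Monster models *)

(* [kappa] stands for the cardinality of a type; [X] is small when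
   [#|X| < kappa]. *)
Definition small (kappa : Type) {T : Type} (X : set T) : Prop :=
  ~ ([set: kappa] #<= X)%card.

Definition saturated {L} (kappa : Type) (M : structure L) : Prop :=
  forall (A : set M) (p : set (formula_over 1 A)), small kappa A ->
    (forall q : set (formula_over 1 A), finite_set q -> q `<=` p ->
      exists x, forall phi, q phi -> holds phi x) ->
    exists x, forall phi, p phi -> holds phi x.

Definition automorphism {L} (M : structure L) (s : M -> M) : Prop :=
  [/\ bijective s,
      forall f args, s (fint M f args) = fint M f (s \o args) &
      forall r args, rint M r args <-> rint M r (s \o args)].

Definition strongly_homogeneous {L} (kappa : Type) (M : structure L) : Prop :=
  forall (A : set M) (g : A -> M), small kappa A ->
    (forall phi : formula L A, sat phi (val : A -> M) <-> sat phi g) ->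
    exists2 s : M -> M, automorphism s & forall a : A, s (val a) = g a.

(* The size conditions say [kappa > |L| + 2 ^ aleph_0]; in particular sequences
   indexed by [0, 1] are small. *)
Record monster {L} (kappa : Type) (T : theory L) (C : structure L) : Prop :=
  Monster {
    monster_models : models C T;
    monster_continuum : small kappa [set: set nat];
    monster_func : small kappa [set: funsym L];
    monster_rel : small kappa [set: relsym L];
    monster_saturated : saturated kappa C;
    monster_homogeneous : strongly_homogeneous kappa C }.

(** * Linear orders and indiscernible sequences *)

Definition linear_order {J : Type} (lt : J -> J -> Prop) : Prop :=
  [/\ forall i, ~ lt i i,
      forall i j k, lt i j -> lt j k -> lt i k &
      forall i j, [\/ lt i j, i = j | lt j i]].

Definition dense_order {J : Type} (lt : J -> J -> Prop) : Prop :=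
  forall i j, lt i j -> exists k, lt i k /\ lt k j.

Definition no_last {J : Type} (lt : J -> J -> Prop) : Prop :=
  forall i, exists j, lt i j.

Definition no_first {J : Type} (lt : J -> J -> Prop) : Prop :=
  forall i, exists j, lt j i.

Definition lt_sum {J1 J2 : Type} (lt1 : J1 -> J1 -> Prop)
    (lt2 : J2 -> J2 -> Prop) (i j : J1 + J2) : Prop :=
  match i, j with
  | inl i1, inl j1 => lt1 i1 j1
  | inl _, inr _ => True
  | inr _, inl _ => False
  | inr i2, inr j2 => lt2 i2 j2
  end.

Definition lt_point (i j : unit) : Prop := False.

Definition increasing {J : Type} (lt : J -> J -> Prop) {k} (s : 'I_k -> J) :=
  forall p q : 'I_k, (p < q)%N -> lt (s p) (s q).

(* [a] is a sequence of [n]-tuples indexed by [(J, lt)]; in [phi] the variable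
   [(p, q)] is the [q]-th coordinate of the [p]-th chosen tuple. *)
Definition indiscernible {L} {M : structure L} {n} {J : Type}
    (lt : J -> J -> Prop) (a : J -> tup M n) (A : set M) : Prop :=
  forall (k : nat) (phi : formula L ('I_k * 'I_n + A)) (s t : 'I_k -> J),
    increasing lt s -> increasing lt t ->
    (sat phi (vjoin (fun pq => a (s pq.1) pq.2) val) <->
     sat phi (vjoin (fun pq => a (t pq.1) pq.2) val)).

(* The set of all coordinates of all members of a sequence. *)
Definition seq_set {L} {M : structure L} {n} {J : Type}
    (a : J -> tup M n) : set M := [set c | exists j i, c = a j i].

(** * Dividing and TP2 *)

(* For small [J], a set [{phi(x, b_i) : i in J}] is consistent with the theory
   of the monster exactly when it is realized in it. *)
Definition consistent {L} {M : structure L} {n m} {J : Type}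
    (phi : formula L ('I_n + 'I_m)) (b : J -> tup M m) : Prop :=
  exists x : tup M n, forall i, sat phi (vjoin x (b i)).

Definition divides {L} {M : structure L} {n m}
    (phi : formula L ('I_n + 'I_m)) (b : tup M m) (A : set M) : Prop :=
  exists bs : nat -> tup M m,
    [/\ indiscernible (fun i j : nat => (i < j)%N) bs A,
        bs 0%N = b & ~ consistent phi bs].

Definition k_inconsistent {L} {M : structure L} {n m} (k : nat)
    (phi : formula L ('I_n + 'I_m)) (b : nat -> tup M m) : Prop :=
  forall f : 'I_k -> nat, injective f -> ~ consistent phi (b \o f).

Definition TP2 {L} (C : structure L) {n m}
    (phi : formula L ('I_n + 'I_m)) : Prop :=
  exists (a : nat -> nat -> tup C m) (k : nat),
    (forall eta : nat -> nat, consistent phi (fun i => a i (eta i))) /\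
    (forall i, k_inconsistent k phi (a i)).

Definition NTP2 {L} (C : structure L) : Prop :=
  forall n m (phi : formula L ('I_n + 'I_m)), ~ TP2 C phi.

(** * Keisler measures *)

(* [keisler_equiv] says that [mu] is a function on the Boolean algebra of
   formulas up to equivalence in [C]. *)
Record keisler_measure {R : realType} {L} {C : structure L} {n}
    (A : set C) (mu : formula_over n A -> R) : Prop := KeislerMeasure {
  keisler_equiv : forall phi psi, (forall x, holds phi x <-> holds psi x) ->
    mu phi = mu psi;
  keisler_ge0 : forall phi, 0 <= mu phi;
  keisler_top : mu Top = 1;
  keisler_add : forall phi psi, (forall x, ~ (holds phi x /\ holds psi x)) ->
    mu (Or phi psi) = mu phi + mu psi }.

Definition NTP2_smooth {R : realType} {L} (kappa : Type) {C : structure L} {n}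
    (A : set C) (mu : formula_over n A -> R) : Prop :=
  forall (B : set C) (AB : A `<=` B) (mu' : formula_over n B -> R),
    small kappa B -> keisler_measure mu' ->
    (forall phi, mu' (formula_incl AB phi) = mu phi) ->
    forall m (phi : formula L ('I_n + 'I_m)) (b : 'I_m -> B),
      divides phi (val \o b) A -> mu' (inst phi b) = 0.

Definition unit_interval (R : realType) : Type := set_type `[0 : R, 1]%classic.

Definition lt_unit (R : realType) (i j : unit_interval R) : Prop :=
  val i < val j.

Definition average_measure {R : realType} {L} {C : structure L} {n}
    (a : unit_interval R -> tup C n)
    (D : formula_over n (seq_set a)) : R :=
  fine (lebesgue_measure [set val i | i in [set i | holds D (a i)]]).

Arguments average_measure {R L C n} a D.

Definition NTP2_distal (R : realType) {L} (kappa : Type)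
    (C : structure L) : Prop :=
  NTP2 C /\
  forall n (a : unit_interval R -> tup C n),
    indiscernible (@lt_unit R) a set0 ->
    NTP2_smooth kappa (average_measure a).

(* Main.v *)
Require Import Defs.
From mathcomp Require Import all_boot all_order all_algebra.
From mathcomp Require Import all_classical all_reals all_analysis.
From mathcomp Require Import lra.

Set Implicit Arguments.
Unset Strict Implicit.
Unset Printing Implicit Defensive.

Import Order.TTheory GRing.Theory Num.Theory.

(** From left to right, let [e] be an increasing omega-sequence in the left half
    of the cut. Stretch it, over a sequence [bs] witnessing the dividing of
    [phi(x, d)], to an indiscernible sequence [a] indexed by [[0, 1]]. Every cut of
    [a] is then filled by some [c_t] satisfying [phi(x, d)], and averaging the
    types of the [c_t] with a finitely additive extension of Lebesgue measure to
    all subsets of [[0, 1]] extends the average measure of [a] and gives measure 1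
    to the dividing formula [phi(x, d)].

    From right to left, let an extension of the average measure of [a] give
    positive measure to [phi(x, d)]. A gap of [a] that no realization of
    [phi(x, d)] fills is covered, by compactness, by a formula over [a] that is
    inconsistent with [phi(x, d)]. Such formulas cannot exhaust [[0, 1]] up to
    measure 0, so there is an increasing sequence of points all of whose
    consecutive gaps are filled by realizations of [phi(x, d)]. Stretching it to
    the order type [Q + 1 + Q] and filling the middle point contradicts the cut
    condition.

    Stretching uses an iterated ultrafilter limit instead of Ramsey's theorem. *)

(** * Formulas: renaming of variables, finite support, definability of existential quantification *)

Section Formulas.
Local Open Scope classical_set_scope.
Context {L : language} {M : structure L}.
Implicit Types V W X Y : Type.

Lemma finite_set_range {T : Type} (A : set T) :
  finite_set A -> exists n (g : 'I_n -> T), A = range g.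
Proof.
elim/Pchoice: T => T in A * => /finite_seqP[s ->].
exists (size s), (tnth (in_tuple s)); apply/seteqP; split=> x /=.
  by move=> /(tnthP (in_tuple s))[i ->]; exists i.
by move=> [i _ <-]; exact: mem_tnth.
Qed.

Lemma vjoin_comp {X Y Z W} (f : X -> Z) (g : Y -> Z) (h : Z -> W) :
  h \o vjoin f g = vjoin (h \o f) (h \o g).
Proof. by apply/funext => -[]. Qed.

Lemma vjoin_inlr {X Y Z} (f : X + Y -> Z) : vjoin (f \o inl) (f \o inr) = f.
Proof. by apply/funext => -[]. Qed.

Lemma term_eval_map {V W} (g : V -> W) (t : term L V) (v : W -> M) :
  term_eval (term_map g t) v = term_eval t (v \o g).
Proof.
by elim: t => //= f args IH; congr fint; apply/funext => i; exact: IH.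
Qed.

Lemma sat_map {V W} (g : V -> W) (phi : formula L V) (v : W -> M) :
  sat (formula_map g phi) v <-> sat phi (v \o g).
Proof.
elim: phi W g v => {V} [V|V t u|V r args|V phi1 IH1 phi2 IH2|V psi IH] W g v /=.
- by [].
- by rewrite !term_eval_map.
- suff -> : (fun i => term_eval (term_map g (args i)) v) =
    (fun i => term_eval (args i) (v \o g)) by [].
  by apply/funext => i; exact: term_eval_map.
- by rewrite IH1 IH2.
- have E c : oapp v c \o omap g = oapp (v \o g) c by apply/funext => -[].
  by split=> H c; have := H c; rewrite IH E.
Qed.

Definition And {V} (phi psi : formula L V) := Not (Imp phi (Not psi)).
Definition Iff {V} (phi psi : formula L V) := And (Imp phi psi) (Imp psi phi).
Definition Ex {V} (phi : formula L (option V)) := Not (All (Not phi)).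

Lemma sat_And {V} (phi psi : formula L V) (v : V -> M) :
  sat (And phi psi) v <-> sat phi v /\ sat psi v.
Proof. by rewrite /=; split=> [/not_implyP[? /contrapT]|[? ?] /(_ _)]//; tauto. Qed.

Lemma sat_Iff {V} (phi psi : formula L V) (v : V -> M) :
  sat (Iff phi psi) v <-> (sat phi v <-> sat psi v).
Proof. by rewrite sat_And /=; tauto. Qed.

Lemma sat_Ex {V} (phi : formula L (option V)) (v : V -> M) :
  sat (Ex phi) v <-> exists c, sat phi (oapp v c).
Proof.
rewrite /=; split=> [/existsNP[c /contrapT]|[c cP]]; first by exists c.
by move/(_ c).
Qed.

Definition support {V} (phi : formula L V) (X : set V) :=
  forall v w : V -> M, {in X, v =1 w} -> (sat phi v <-> sat phi w).

Lemma term_support {V} (t : term L V) : exists2 X, finite_set X &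
  forall v w : V -> M, {in X, v =1 w} -> term_eval t v = term_eval t w.
Proof.
elim: t => [x|f args IH].
  by exists [set x] => // v w; apply; rewrite inE.
have /choice[X /all_and2[Xfin XP]] : forall i : 'I_(farity f), exists Z, finite_set Z /\
    forall v w : V -> M, {in Z, v =1 w} ->
    term_eval (args i) v = term_eval (args i) w.
  by move=> i; have [Z] := IH i; exists Z.
exists (\bigcup_i X i) => [|v w vw /=]; first exact: bigcup_finite.
congr fint; apply/funext => i; apply: XP => x /set_mem xX.
by apply: vw; apply/mem_set; exists i.
Qed.

(** Arities are finite, so the supports of the arguments of a symbol have a finite union; under a
    quantifier the support is pulled back along [Some]. This keeps formulas over infinite variable
    types finitary. *)
Lemma formula_support {V} (phi : formula L V) :
  exists2 X, finite_set X & support phi X.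
Proof.
elim: phi => {V} [V|V t u|V r args|V phi1 [X1 f1 s1] phi2 [X2 f2 s2]|V psi [X Xf Xs]].
- by exists set0.
- have [X Xf Xs] := term_support t; have [Y Yf Ys] := term_support u.
  exists (X `|` Y); first by rewrite finite_setU.
  move=> v w vw /=; rewrite (Xs v w) ?(Ys v w)// => x xX; apply: vw; apply/mem_set.
    by right; exact: set_mem.
  by left; exact: set_mem.
- have /choice[X /all_and2[Xfin XP]] : forall i : 'I_(rarity r), exists Z, finite_set Z /\
      forall v w : V -> M, {in Z, v =1 w} ->
      term_eval (args i) v = term_eval (args i) w.
    by move=> i; have [Z] := term_support (args i); exists Z.
  exists (\bigcup_i X i) => [|v w vw /=]; first exact: bigcup_finite.
  suff -> : (fun i => term_eval (args i) v) = (fun i => term_eval (args i) w) by [].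
  apply/funext => i; apply: XP => x /set_mem xX.
  by apply: vw; apply/mem_set; exists i.
- exists (X1 `|` X2); first by rewrite finite_setU.
  move=> v w vw /=; rewrite (s1 v w) ?(s2 v w)// => x xX; apply: vw; apply/mem_set.
    by right; exact: set_mem.
  by left; exact: set_mem.
- exists (Some @^-1` X).
    by apply: finite_preimage => // x y _ _ [].
  move=> v w vw /=.
  have E c : sat psi (oapp v c) <-> sat psi (oapp w c).
    apply: Xs => -[x|]//= /set_mem xX.
    by apply: vw; apply/mem_set.
  by split=> H c; apply/E.
Qed.

Lemma ex_ord_definable {W} k (theta : formula L (W + 'I_k)) :
  exists theta' : formula L W, forall v : W -> M,
    sat theta' v <-> exists u : 'I_k -> M, sat theta (vjoin v u).
Proof.
elim: k theta => [|k IH] theta.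
  pose r (x : W + 'I_0) : W := match x with inl w => w
    | inr i => False_rect W (notF (ltn_ord i)) end.
  exists (formula_map r theta) => v; rewrite sat_map.
  have E u : v \o r = vjoin v u by apply/funext => -[//|[]//].
  split=> [H|[u]]; last by rewrite -E.
  by exists (fun i : 'I_0 => False_rect M (notF (ltn_ord i))); rewrite -E.
(* The variable [ord0] becomes the bound variable [None]; the others shift down through [unlift]. *)
pose r (x : W + 'I_k.+1) : option (W + 'I_k) :=
  match x with inl w => Some (inl w) | inr i => omap inr (unlift ord0 i) end.
have [theta' H'] := IH (Ex (formula_map r theta)).
exists theta' => v; rewrite H'.
have E u c : oapp (vjoin v u) c \o r =
    vjoin v (fun i => oapp u c (unlift ord0 i)).
  by apply/funext => -[//|i] /=; case: unliftP.
split=> [[u /sat_Ex[c /sat_map]]|[u Hu]].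
  by rewrite E => Hu; exists (fun i => oapp u c (unlift ord0 i)).
exists (u \o lift ord0); apply/sat_Ex; exists (u ord0); apply/sat_map; rewrite E.
suff -> : (fun i => oapp (u \o lift ord0) (u ord0) (unlift ord0 i)) = u by [].
by apply/funext => i; case: unliftP => [j|] ->.
Qed.

(* Only finitely many of the variables in [Y] occur in the formula, so
   quantifying over all of [Y -> M] is still first-order. *)
Lemma ex_definable {W Y} (theta : formula L (W + Y)) :
  exists theta' : formula L W, forall v : W -> M,
    sat theta' v <-> exists u : Y -> M, sat theta (vjoin v u).
Proof.
have [X Xf Xs] := formula_support theta.
have /finite_set_range[k [g gE]] : finite_set (inr @^-1` X : set Y).
  by apply: finite_preimage => // x y _ _ [].
(* [r] renames the variables of [Y] in the support of [theta] to some [lift ord0 i]; the spare slot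
   [ord0] takes all the others, so that [r] exists even when [k] is 0. *)
have /choice[r rP] : forall y, exists z : 'I_k.+1, X (inr y) ->
    exists2 i : 'I_k, g i = y & z = lift ord0 i.
  move=> y; case: (pselect (X (inr y))) => [|nX]; last by exists ord0.
  rewrite -[X _]/((inr @^-1` X) y) gE => -[i _ gi].
  by exists (lift ord0 i) => _; exists i.
have [theta' H'] := ex_ord_definable
  (formula_map (vjoin inl (inr \o r)) theta).
have [c0] := carrier_inhabited M.
exists theta' => v; rewrite H'; split=> -[u].
  rewrite sat_map vjoin_comp => Hu; by exists (u \o r).
move=> Hu; exists (fun i => oapp (u \o g) c0 (unlift ord0 i)).
rewrite sat_map vjoin_comp -(Xs (vjoin v u))// => -[//|y] /set_mem /rP[i giy riy] /=.
by rewrite riy liftK /= giy.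
Qed.

End Formulas.

(** * Types of size at most the continuum *)

Section Continuum.
Local Open Scope classical_set_scope.

(** Allowing any countable type in place of [nat] reduces closure under products to forming sums of
    countable types. *)
Definition le_continuum (T : Type) :=
  exists (K : countType) (f : T -> set K), injective f.

Lemma le_continuum_inj {S T : Type} (f : S -> T) :
  injective f -> le_continuum T -> le_continuum S.
Proof. by move=> fI [K [g gI]]; exists K, (g \o f); exact: inj_comp. Qed.

Lemma le_continuum_count (T : countType) : le_continuum T.
Proof.
exists T, (fun x => [set x]) => x y /seteqP[xy _].
by have := xy x erefl.
Qed.

Lemma le_continuum_prod {S T : Type} :
  le_continuum S -> le_continuum T -> le_continuum (S * T).
Proof.
move=> [K [f fI]] [K' [g gI]].
exists (K + K')%type, (fun p => (inl @` f p.1) `|` (inr @` g p.2)).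
move=> -[x y] [x' y'] /seteqP[/= s1 s2]; congr pair.
  apply: fI; apply/seteqP; split=> k kP.
    by have /s1[[? ? [<-]]|[]] : ((inl @` f x) `|` (inr @` g y)) (inl k) by left; exists k.
  by have /s2[[? ? [<-]]|[]] : ((inl @` f x') `|` (inr @` g y')) (inl k) by left; exists k.
apply: gI; apply/seteqP; split=> k kP.
  by have /s1[[]|[? ? [<-]]] : ((inl @` f x) `|` (inr @` g y)) (inr k) by right; exists k.
by have /s2[[]|[? ? [<-]]] : ((inl @` f x') `|` (inr @` g y')) (inr k) by right; exists k.
Qed.

Lemma le_continuum_sum {S T : Type} :
  le_continuum S -> le_continuum T -> le_continuum (S + T).
Proof.
move=> cS cT; have [[y0]|nT] := pselect (inhabited T).
  have [[x0]|nS] := pselect (inhabited S).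
    pose f (z : S + T) : bool * (S * T) :=
      match z with inl x => (true, (x, y0)) | inr y => (false, (x0, y)) end.
    apply: (@le_continuum_inj _ _ f); first by move=> [x|y] [x'|y'] // [->].
    by apply: le_continuum_prod; [exact: le_continuum_count|exact: le_continuum_prod].
  apply: (@le_continuum_inj _ _ (fun z : S + T => match z with
    inl x => y0 | inr y => y end)) => // -[x|y] [x'|y'] /=; last by move=> ->.
  1-3: by case: nS; constructor.
apply: (@le_continuum_inj _ _ (fun z : S + T => match z with
  inl x => x | inr y => False_rect S (nT (inhabits y)) end)) => //.
move=> [x|y] [x'|y'] /=; first by move=> ->.
all: by case: nT; constructor.
Qed.

Lemma le_continuum_image {S T : Type} (f : S -> T) (A : set T) :
  A `<=` range f -> le_continuum S -> le_continuum A.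
Proof.
move=> Af; have /choice[g gP] : forall x : A, exists y, f y = val x.
  by move=> x; have [y _ fy] := Af _ (set_valP x); exists y.
by apply: (@le_continuum_inj _ _ g) => x y gxy; apply: val_inj; rewrite -!gP gxy.
Qed.

(** A real number is determined by the set of rationals below it. *)
Lemma le_continuum_real (R : realType) : le_continuum R.
Proof.
exists rat, (fun x => [set q | ratr q < x]%R) => x y.
move=> /seteqP[/= s1 s2]; apply/eqP; rewrite eq_le; apply/andP.
by split; rewrite leNgt; apply/negP => /rat_in_itvoo[q];
  rewrite in_itv /= => /andP[q1 q2]; have := lt_trans q1 q2;
  [have := s1 _ q2|have := s2 _ q2]; rewrite /= ltNge (ltW q1).
Qed.

(** Otherwise [kappa] would embed into [A], hence into [S] and into [set nat], which the first
    hypothesis excludes. *)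
Lemma le_continuum_small {kappa T S : Type} (A : set T) (f : S -> T) :
  small kappa [set: set nat] -> le_continuum S -> A `<=` range f ->
  small kappa A.
Proof.
move=> hk [K [g gI]] Af kA; apply: hk.
apply: (card_le_trans kA); apply: (card_le_trans (subset_card_le Af)).
apply: (card_le_trans (card_image_le _ _)).
apply/pcard_injP; exists (fun s => pickle @` g s).
move=> s s' _ _ /seteqP[h1 h2]; apply: gI; apply/seteqP; split=> k kP.
  by have [|k' ? /(pcan_inj pickleK) <-] := h1 (pickle k); first by exists k.
by have [|k' ? /(pcan_inj pickleK) <-] := h2 (pickle k); first by exists k.
Qed.

End Continuum.

(** * Compactness in many variables from saturation for 1-types *)

Section Compactness.
Local Open Scope classical_set_scope.

Lemma chain_finite_sub {T : Type} (F : set (set T)) (Y : set T) :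
  F !=set0 -> total_on F subset -> finite_set Y ->
  Y `<=` \bigcup_(X in F) X -> exists2 X, F X & Y `<=` X.
Proof.
move=> [X0 FX0] totF /finite_set_range[k [g ->]].
elim: k g => [|k IH] g gF; first by exists X0 => // x [[]].
have [X FX gX] : exists2 X, F X & range (g \o lift ord0) `<=` X.
  by apply: IH => x [i _ <-]; apply: gF; exists (lift ord0 i).
have [X' FX' g0] : (\bigcup_(X in F) X) (g ord0) by apply: gF; exists ord0.
have gP Z : X `<=` Z -> X' `<=` Z -> range g `<=` Z.
  move=> XZ X'Z x [i _ <-]; case: (unliftP ord0 i) => [j|] ->; last exact: X'Z.
  by apply: XZ; apply: gX; exists j.
by have [XX'|X'X] := totF _ _ FX FX'; [exists X'|exists X] => //; exact: gP.
Qed.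

Context {L : language} {kappa : Type} {C : structure L}.
Hypothesis kC : small kappa [set: set nat].
Hypothesis satC : saturated kappa C.

(** Directedness stands in for finite satisfiability: a finite part of a nonempty [Sigma] follows
    from one of its members, so only single members have to be satisfied. *)
Definition directed_formulas {V : Type} (Sigma : set (formula L V)) :=
  forall th1 th2, Sigma th1 -> Sigma th2 -> exists2 th, Sigma th &
    forall v : V -> C, sat th v -> sat th1 v /\ sat th2 v.

Lemma directed_finite {V : Type} (Sigma q : set (formula L V)) :
  Sigma !=set0 -> directed_formulas Sigma -> finite_set q -> q `<=` Sigma ->
  exists2 th, Sigma th & forall v : V -> C, sat th v -> forall th', q th' -> sat th' v.
Proof.
move=> [th0 S0] dS /finite_set_range[k [g ->]].
elim: k g => [|k IH] g gS; first by exists th0 => // v _ th' [[]].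
have [th Sth thP] : exists2 th, Sigma th & forall v : V -> C, sat th v ->
    forall th', range (g \o lift ord0) th' -> sat th' v.
  by apply: IH => x [i _ <-]; apply: gS; exists (lift ord0 i).
have [th' Sth' th'P] := dS _ _ Sth (gS (g ord0) (ex_intro2 _ _ ord0 I erefl)).
exists th' => // v /th'P[v1 v2] _ [i _ <-].
by case: (unliftP ord0 i) => [j|] -> //; apply: thP => //; exists j.
Qed.

(* Saturation only speaks about 1-types; a maximal partial solution (with
   respect to Zorn's lemma) realizes a type in up to continuum many variables. *)
Lemma compactness {W P : Type} (p : P -> C) (Sigma : set (formula L (W + P))) :
  le_continuum W -> le_continuum P ->
  Sigma !=set0 -> directed_formulas Sigma ->
  (forall th, Sigma th -> exists w : W -> C, sat th (vjoin w p)) ->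
  exists w : W -> C, forall th, Sigma th -> sat th (vjoin w p).
Proof.
move=> cW cP S0 dS fS.
(* [G] is the graph of a partial assignment; it is [good] when each formula of [Sigma] has a
   solution extending it. *)
pose extends (G : set (W * C)) (w : W -> C) := forall x c, G (x, c) -> w x = c.
pose good (G : set (W * C)) := forall th, Sigma th ->
  exists2 w, extends G w & sat th (vjoin w p).
have functional G x c c' : good G -> G (x, c) -> G (x, c') -> c = c'.
  move=> gG Gc Gc'; have [th Sth] := S0; have [w wG _] := gG _ Sth.
  by rewrite -(wG _ _ Gc) (wG _ _ Gc').
have [F gF totF|G [gG maxG]] := @Zorn_bigcup _ good.
  move=> th Sth.
  have [F0|nF] := pselect (F !=set0); last first.
    have [w wP] := fS _ Sth; exists w => // x c [G FG].
    by case: nF; exists G.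
  have totU x c c' : (\bigcup_(X in F) X) (x, c) -> (\bigcup_(X in F) X) (x, c') ->
      c = c'.
    move=> [G FG Gc] [G' FG' Gc'].
    have [GG'|G'G] := totF _ _ FG FG'.
      exact: (functional G' x _ _ (gF _ FG') (GG' _ Gc) Gc').
    exact: (functional G x _ _ (gF _ FG) Gc (G'G _ Gc')).
  (* Only the values of the union on the finite support of [th] matter, and these already occur in
     one member of the chain. A solution extending that member is then overwritten by the whole
     union. *)
  have [X Xf Xs] := @formula_support _ C _ th.
  pose Y := [set xc | (\bigcup_(X in F) X) xc /\ X (inl xc.1)].
  have Yf : finite_set Y.
    have Zf : finite_set (inl @^-1` X : set W).
      by apply: finite_preimage => // ? ? _ _ [].
    have [c0] := carrier_inhabited C.
    have /choice[r rP] : forall x : W, exists c, forall c', Y (x, c') -> c' = c.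
      move=> x; have [[c Yc]|nY] := pselect (exists c, Y (x, c)).
        by exists c => c' Yc'; exact: totU Yc'.1 Yc.1.
      by exists c0 => c' Yc'; case: nY; exists c'.
    apply: (@sub_finite_set _ _ ((fun x => (x, r x)) @` (inl @^-1` X))).
      by move=> [x c] Yxc; exists x; [exact: Yxc.2|rewrite -(rP _ _ Yxc)].
    exact: finite_image.
  have [G FG YG] := chain_finite_sub F0 totF Yf (fun xc h => h.1).
  have [w wG wth] := gF _ FG _ Sth.
  have /choice[w' w'P] : forall x, exists c, (forall c', (\bigcup_(X in F) X) (x, c') ->
      c = c') /\ ((forall c', ~ (\bigcup_(X in F) X) (x, c')) -> c = w x).
    move=> x; have [[c Uc]|nU] := pselect (exists c, (\bigcup_(X in F) X) (x, c)).
      by exists c; split=> [c' Uc'|/(_ c)//]; exact: totU Uc Uc'.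
    by exists (w x); split=> // c' Uc'; case: nU; exists c'.
  exists w' => [x c Uc|]; first exact: (w'P x).1.
  rewrite -(Xs (vjoin w p))// => -[x|//] /set_mem Xx /=.
  have [[c Uc]|nU] := pselect (exists c, (\bigcup_(X in F) X) (x, c)).
    by rewrite ((w'P x).1 _ Uc); apply: wG; apply: YG.
  by rewrite (w'P x).2// => c Uc; apply: nU; exists c.
have [domG|/existsNP[x0 x0G]] := pselect (forall x, exists c, G (x, c)).
  have [g gP] := choice domG; exists g => th Sth.
  have [w wG wth] := gG _ Sth.
  by suff -> : g = w by []; apply/funext => x; rewrite (wG _ _ (gP x)).
(* A maximal [G] undefined at [x0] could be extended: [p1] consists of the formulas in one variable
   saying that a given member of [Sigma] has a solution extending [G] with that variable as its
   value at [x0]. Saturation over [A] realizes [p1]. *)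
exfalso.
have [c0] := carrier_inhabited C.
have /choice[f fP] : forall x, exists c, forall c', G (x, c') -> c = c'.
  move=> x; have [[c Gc]|nG] := pselect (exists c, G (x, c)).
    by exists c => c' Gc'; exact: functional Gc Gc'.
  by exists c0 => c' Gc'; case: nG; exists c'.
pose A := range (vjoin f p).
have smallA : small kappa A.
  by apply: (@le_continuum_small _ _ _ _ (vjoin f p)) => //; exact: le_continuum_sum.
have inA y : A (vjoin f p y) by exists y.
pose toA y : A := SigSub (mem_set (inA y)).
pose p1 : set (formula_over 1 A) := [set chi | exists2 th, Sigma th &
  forall c, holds chi c <-> exists w, [/\ extends G w, w x0 = c ord0 &
    sat th (vjoin w p)]].
have p1P th : Sigma th -> exists2 chi, p1 chi & forall c, holds chi c <->
    exists w, [/\ extends G w, w x0 = c ord0 & sat th (vjoin w p)].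
  move=> Sth.
  (* [r] sends [x0] to the single variable, sends the domain of [G] and all of [P] to parameters,
     and leaves the rest to be quantified by [ex_definable]. *)
  pose r (y : W + P) : ('I_1 + A) + W := match y with
    | inl x => if pselect (x = x0) then inl (inl ord0) else
               if pselect (exists c, G (x, c)) then inl (inr (toA (inl x)))
               else inr x
    | inr z => inl (inr (toA (inr z))) end.
  have [chi chiP] := @ex_definable _ C _ _ (formula_map r th).
  suff chiE c : holds chi c <-> exists w, [/\ extends G w, w x0 = c ord0 &
      sat th (vjoin w p)] by exists chi => //; exists th.
  rewrite /holds chiP; split=> [[u]|[w [wG w0 wth]]].
    rewrite sat_map => uth.
    exists (fun x => vjoin (vjoin c val) u (r (inl x))); split.
    - move=> x c' Gc' /=; case: pselect => [xx0|_] /=.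
        by case: x0G; exists c'; rewrite -xx0.
      case: pselect => [_|nG] /=; first exact: fP.
      by case: nG; exists c'.
    - by move=> /=; case: pselect.
    - suff -> : vjoin (fun x => vjoin (vjoin c val) u (r (inl x))) p =
        vjoin (vjoin c val) u \o r by [].
      by apply/funext => -[].
  exists w; rewrite sat_map.
  suff -> : vjoin (vjoin c val) w \o r = vjoin w p by [].
  apply/funext => -[x|//] /=; case: pselect => [xx0|_] /=; first by rewrite xx0.
  case: pselect => [[c' Gc']|//] /=.
  by rewrite (wG _ _ Gc') (fP _ _ Gc').
have [q qf qp1|c cp1] := satC smallA (p := p1).
  have [[chi0 q0]|nq] := pselect (q !=set0); last first.
    by exists (fun=> c0) => chi qchi; case: nq; exists chi.
  have /finite_set_range[k [g gE]] := qf.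
  have /choice[h hP] : forall i : 'I_k, exists th, Sigma th /\
      forall c, holds (g i) c <-> exists w, [/\ extends G w, w x0 = c ord0 &
      sat th (vjoin w p)].
    by move=> i; have [|th] := qp1 (g i); [rewrite gE; exists i|exists th].
  have [|_ [i _ <-]|th Sth thP] := directed_finite (q := range h) S0 dS.
  - by apply: finite_image.
  - exact: (hP i).1.
  have [w wG wth] := gG _ Sth.
  exists (fun=> w x0) => chi; rewrite gE => -[i _ <-].
  by apply/(hP i).2; exists w; split => //; apply: thP wth _ _; exists i.
pose G' := G `|` [set (x0, c ord0)].
apply: (maxG G').
  split=> [|G'G]; last first.
    by apply: x0G; exists (c ord0); apply: G'G; right.
  by move=> xc; left.
move=> th Sth; have [chi p1chi chiP] := p1P _ Sth.
have /chiP[w [wG w0 wth]] := cp1 _ p1chi.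
by exists w => // x c' [/wG//|[-> ->]].
Qed.

End Compactness.

(** * Iterated ultrafilter limits on tuples of natural numbers *)

Section IteratedUltrafilter.
Local Open Scope classical_set_scope.
Context (U : set_system nat) {UU : UltraFilter U}.
Hypothesis U_large : forall b, U [set i | (b < i)%N].

(** The [k]-fold Fubini product of [U] with itself: [Q] holds for [U]-almost all first entries, then
    for [U]-almost all second entries, and so on. *)
Fixpoint itU k (Q : seq nat -> Prop) : Prop :=
  if k is k'.+1 then U [set i | itU k' (fun s => Q (i :: s))] else Q [::].

Lemma itU_mono k (Q Q' : seq nat -> Prop) :
  (forall s, size s = k -> Q s -> Q' s) -> itU k Q -> itU k Q'.
Proof.
elim: k Q Q' => [|k IH] Q Q' QQ' /=; first exact: QQ'.
by apply: filterS => i; apply: IH => s sk; apply: QQ'; rewrite /= sk.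
Qed.

Lemma itU_and k (Q Q' : seq nat -> Prop) :
  itU k Q -> itU k Q' -> itU k (fun s => Q s /\ Q' s).
Proof.
elim: k Q Q' => [|k IH] Q Q' //= h h'.
by apply: filterS2 h h' => i; exact: IH.
Qed.

Lemma itU_not k (Q : seq nat -> Prop) : ~ itU k Q -> itU k (fun s => ~ Q s).
Proof.
elim: k Q => [|k IH] Q //= h.
have [//|] := in_ultra_setVsetC [set i | itU k (fun s => Q (i :: s))] UU.
by apply: filterS => i; exact: IH.
Qed.

Lemma itU_ex k (Q : seq nat -> Prop) : itU k Q -> exists2 s, size s = k & Q s.
Proof.
elim: k Q => [|k IH] Q /=; first by exists [::].
by move=> /filter_ex[i /IH[s <- Qs]]; exists (i :: s).
Qed.

Lemma itU_path k b : itU k (path ltn b).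
Proof.
elim: k b => [|k IH] b //=.
apply: filterS (U_large b) => i /= bi.
by apply: itU_mono (IH i) => s _; rewrite bi.
Qed.

Lemma itU_sorted k : itU k (sorted ltn).
Proof. by apply: itU_mono (itU_path k 0) => s _; exact: path_sorted. Qed.

(** A coordinate dropped by the mask is quantified vacuously, and the whole of [nat] belongs to
    [U]. *)
Lemma itU_mask m (Q : seq nat -> Prop) :
  itU (count id m) Q -> itU (size m) (fun s => Q (mask m s)).
Proof.
elim: m Q => [|[] m IH] Q //=; first by apply: filterS => i; exact: IH.
by move=> /IH h; apply: filterS filterT => i _.
Qed.

(** This makes the limits for different arities cohere. The image of [rho] is encoded as a mask of
    [iota 0 N]; selecting by it lists the values of [rho] in increasing order. *)
Lemma itU_reindex k N (rho : 'I_k -> 'I_N) (Q : ('I_k -> nat) -> Prop) :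
  (forall p q : 'I_k, (p < q)%N -> (rho p < rho q)%N) ->
  itU k (fun s => Q (fun i => nth 0%N s i)) ->
  itU N (fun s => Q (fun i => nth 0%N s (rho i))).
Proof.
move=> rhoI h.
pose ts : seq nat := [seq (rho i : nat) | i <- enum 'I_k].
pose m := [seq i \in ts | i <- iota 0 N].
have szm : size m = N by rewrite size_map size_iota.
have maskE : mask m (iota 0 N) = ts.
  rewrite -filter_mask; apply: (irr_sorted_eq ltn_trans ltnn).
  - by apply: sorted_filter; [exact: ltn_trans|exact: iota_ltn_sorted].
  - rewrite sorted_map.
    have := iota_ltn_sorted 0 k; rewrite -val_enum_ord sorted_map.
    by apply: sub_sorted => p q /=; exact: rhoI.
  - move=> i; rewrite mem_filter mem_iota add0n /=.
    by apply/andP/idP => [[]//|it]; split=> //; have /mapP[j _ ->] := it.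
have szts : size ts = k by rewrite size_map size_enum_ord.
have cm : count id m = k by rewrite -szts -maskE size_mask // size_iota.
have := @itU_mask m (fun s => Q (fun i : 'I_k => nth 0%N s i)).
rewrite szm cm => /(_ h); apply: itU_mono => s ss.
suff -> : (fun i : 'I_k => nth 0%N (mask m s) i) = (fun i => nth 0%N s (rho i)) by [].
apply/funext => i.
rewrite -{1}(mkseq_nth 0%N s) /mkseq -map_mask ss maskE.
rewrite (nth_map 0%N) ?szts// (nth_map i) ?size_enum_ord//.
by rewrite nth_ord_enum.
Qed.

End IteratedUltrafilter.

(** * Sequences of tuples as assignments, increasing index tuples, finite parts of formulas *)

Definition flat {J T : Type} {n} (g : J -> 'I_n -> T) (jq : J * 'I_n) : T :=
  g jq.1 jq.2.

Definition replace {J T : Type} (g : J -> T) (t : J) (x : T) (j : J) : T :=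
  if `[< j = t >] then x else g j.

Section Rows.
Local Open Scope classical_set_scope.

Lemma replace_eq {J T : Type} (g : J -> T) t x : replace g t x t = x.
Proof. by rewrite /replace asboolT. Qed.

Lemma replace_neq {J T : Type} (g : J -> T) t x j : j <> t -> replace g t x j = g j.
Proof. by move=> jt; rewrite /replace asboolF. Qed.

Lemma increasing_inj {J : Type} (lt : J -> J -> Prop) k (s : 'I_k -> J) :
  linear_order lt -> increasing lt s -> injective s.
Proof.
move=> [irr _ _] incs p q spq; apply/val_inj; case: (ltngtP p q) => // /incs.
  by rewrite spq => /irr.
by rewrite spq => /irr.
Qed.

Lemma increasing_factor {J : Type} (lt : J -> J -> Prop) k N (s : 'I_k -> J)
    (t : 'I_N -> J) :
  linear_order lt -> increasing lt s -> increasing lt t -> range s `<=` range t ->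
  exists2 rho : 'I_k -> 'I_N, s = t \o rho &
    forall p q : 'I_k, (p < q)%N -> (rho p < rho q)%N.
Proof.
move=> [irr tr tot] incs inct st.
have /choice[rho rhoE] : forall i, exists j, t j = s i.
  by move=> i; have [j _ tj] := st (s i) (ex_intro2 _ _ i I erefl); exists j.
exists rho => [|p q pq]; first by apply/funext => i /=; rewrite rhoE.
rewrite ltnNge; apply/negP; rewrite leq_eqVlt => /orP[/eqP/val_inj qp|/inct].
  by have := incs _ _ pq; rewrite -!rhoE qp => /irr.
by rewrite !rhoE => /tr/(_ (incs _ _ pq))/irr.
Qed.

Lemma finite_set_increasing {J : Type} (lt : J -> J -> Prop) (w : set J) :
  linear_order lt -> finite_set w ->
  exists k (s : 'I_k -> J), increasing lt s /\ range s = w.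
Proof.
elim/Pchoice: J => J in lt w *; move=> [irr tr tot] /finite_seqP[s0 ->].
pose leb x y := `[< lt x y \/ x = y >].
have leb_tot : total leb.
  move=> x y; apply/orP; have [xy|xy|xy] := tot x y.
  - by left; apply/asboolP; left.
  - by left; apply/asboolP; right.
  - by right; apply/asboolP; left.
have leb_tr : transitive leb.
  move=> y x z /asboolP[xy|->//] /asboolP[yz|<-]; apply/asboolP; left => //.
  exact: tr xy yz.
pose s := sort leb (undup s0).
have su : uniq s by rewrite sort_uniq undup_uniq.
exists (size s), (tnth (in_tuple s)); split=> [p q pq|].
  have x0 := tnth (in_tuple s) p; rewrite !(tnth_nth x0) /=.
  have /asboolP[//|/eqP] : leb (nth x0 s p) (nth x0 s q).
    by apply: (sorted_ltn_nth leb_tr) => //; rewrite ?inE//; exact: sort_sorted.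
  by rewrite nth_uniq // => /eqP pq'; rewrite pq' ltnn in pq.
apply/seteqP; split=> x /=.
  by move=> [i _ <-]; have := mem_tnth i (in_tuple s); rewrite mem_sort mem_undup.
rewrite -mem_undup -(mem_sort leb) => /(tnthP (in_tuple s))[i ->].
by exists i.
Qed.

Context {L : language} {C : structure L}.

(** Only finitely many indices of [J] occur in a formula, so it can be read along any finite tuple
    [s] containing them. The index [l] is a default for the others; [g] has to agree with [a] only
    on [w], which leaves entries outside [w] free to be replaced. *)
Lemma row_normal_form {Y J : Type} {n} (chi : formula L (Y + J * 'I_n)) :
  exists2 w : set J, finite_set w &
  forall k (s : 'I_k -> J) (l : 'I_k), w `<=` range s ->
  exists chi' : formula L (Y + 'I_k * 'I_n),
  forall (y : Y -> C) (a : J -> tup C n) (g : 'I_k -> tup C n),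
    (forall i, w (s i) -> g i = a (s i)) ->
    (sat chi (vjoin y (flat a)) <-> sat chi' (vjoin y (flat g))).
Proof.
have [X Xf Xs] := @formula_support _ C _ chi.
pose w : set J := fst @` (inr @^-1` X : set (J * 'I_n)).
exists w => [|k s l ws].
  by apply: finite_image; apply: finite_preimage => // ? ? _ _ [].
have /choice[r rP] : forall j, exists i, w j -> s i = j.
  move=> j; have [/ws[i _ si]|nw] := pselect (w j); first by exists i.
  by exists l.
exists (formula_map (vjoin inl (fun jq => inr (r jq.1, jq.2))) chi) => y a g ga.
rewrite sat_map; apply: Xs => -[//|[j q]] /set_mem Xjq /=.
have wj : w j by exists (j, q).
by rewrite /flat /= ga rP.
Qed.

Lemma seq_set_entry {J : Type} {n} (a : J -> tup C n) j i : seq_set a (a j i).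
Proof. by exists j, i. Qed.

Definition entry {J : Type} {n} (a : J -> tup C n) j i : seq_set a :=
  SigSub (mem_set (seq_set_entry a j i)).

Lemma seq_set_rep {J : Type} {n} (a : J -> tup C n) :
  exists rep : seq_set a -> J * 'I_n, forall c, flat a (rep c) = val c.
Proof.
have /choice[r rP] : forall c : seq_set a, exists jq, flat a jq = val c.
  by move=> c; have [j [i ->]] := set_valP c; exists (j, i).
by exists r.
Qed.

End Rows.

(** * Stretching a sequence to another order type, and filling a place of the result *)

Section Stretching.
Local Open Scope classical_set_scope.
Context {L : language} {kappa : Type} {C : structure L}.
Hypothesis kC : small kappa [set: set nat].
Hypothesis satC : saturated kappa C.

Let ltN (i j : nat) : Prop := (i < j)%N.

(* [a] realizes over [p] the Ehrenfeucht-Mostowski type of [e]. *)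
Definition EM_over {P J : Type} {n} (lt : J -> J -> Prop) (p : P -> C)
    (e : nat -> tup C n) (a : J -> tup C n) : Prop :=
  forall k (psi : formula L ('I_k * 'I_n + P)),
    (forall s : 'I_k -> nat, increasing ltN s -> sat psi (vjoin (flat (e \o s)) p)) ->
    forall t : 'I_k -> J, increasing lt t -> sat psi (vjoin (flat (a \o t)) p).

(** The formulas true in the iterated limit along [e] form a type that depends only on the order of
    the chosen entries. An ultrafilter decides every formula, so the type is complete, and
    completeness gives indiscernibility over the parameters [p]. *)
Lemma stretching {P J : Type} {n} (lt : J -> J -> Prop) (p : P -> C)
    (e : nat -> tup C n) :
  linear_order lt -> le_continuum J -> le_continuum P ->
  exists a : J -> tup C n, EM_over lt p e a /\
    forall A, A `<=` range p -> indiscernible lt a A.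
Proof.
move=> ltJ cJ cP.
have [U [UU ooU]] := ultraFilterLemma (F := \oo) _.
have U_large b : U [set i | (b < i)%N] by apply: ooU; exists b.+1.
pose large k (psi : formula L ('I_k * 'I_n + P)) :=
  itU U k (fun s => sat psi (vjoin (flat (e \o (fun i : 'I_k => nth 0%N s i))) p)).
pose lift k (t : 'I_k -> J) (psi : formula L ('I_k * 'I_n + P)) :
    formula L (J * 'I_n + P) :=
  formula_map (vjoin (fun pq => inl (t pq.1, pq.2)) inr) psi.
have liftE k t psi v q : sat (@lift k t psi) (vjoin v q) <->
    sat psi (vjoin (fun pq => v (t pq.1, pq.2)) q).
  by rewrite sat_map vjoin_comp.
pose Sigma : set (formula L (J * 'I_n + P)) := [set th | exists k t psi,
  [/\ increasing lt t, large k psi & th = lift k t psi]].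
have [||_ _ [k1 [t1 [psi1 [inc1 lg1 ->]]]] [k2 [t2 [psi2 [inc2 lg2 ->]]]]|
    _ [k [t [psi [inct lg ->]]]]|a aP] :=
    @compactness _ _ _ kC satC (J * 'I_n)%type P p Sigma _ cP.
- by apply: le_continuum_prod => //; exact: le_continuum_count.
- pose t0 (i : 'I_0) : J := False_rect J (notF (ltn_ord i)).
  by exists (lift 0%N t0 Top), 0%N, t0, Top; split => // -[].
(* Two conditions on different index tuples are rewritten along an increasing enumeration of their
   union. *)
- have [N [t [inct tE]]] : exists k (s : 'I_k -> J), increasing lt s /\
      range s = range t1 `|` range t2.
    by apply: finite_set_increasing => //; rewrite finite_setU; split; exact: finite_image.
  have [|rho1 t1E rho1I] := increasing_factor ltJ inc1 inct.
    by rewrite tE; exact: subsetUl.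
  have [|rho2 t2E rho2I] := increasing_factor ltJ inc2 inct.
    by rewrite tE; exact: subsetUr.
  pose ren k (rho : 'I_k -> 'I_N) : 'I_k * 'I_n + P -> 'I_N * 'I_n + P :=
    vjoin (fun pq => inl (rho pq.1, pq.2)) inr.
  pose psi := And (formula_map (ren _ rho1) psi1) (formula_map (ren _ rho2) psi2).
  exists (lift N t psi).
    exists N, t, psi; split=> //.
    apply: itU_mono (itU_and
      (itU_reindex (Q := fun s => sat psi1 (vjoin (flat (e \o s)) p)) rho1I lg1)
      (itU_reindex (Q := fun s => sat psi2 (vjoin (flat (e \o s)) p)) rho2I lg2)).
    move=> s _ [h1 h2].
    by rewrite sat_And !sat_map !vjoin_comp.
  move=> v; rewrite -(vjoin_inlr v) !liftE sat_And !sat_map !vjoin_comp.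
  by rewrite t1E t2E.
(* A single condition is met inside [e]: a tuple [s] satisfying it is placed at the indices [t], and
   the remaining indices default to position 0. *)
- have [s _ ps] := itU_ex lg.
  have /choice[r rP] : forall j, exists c : nat, forall i : 'I_k, t i = j -> c = i.
    move=> j; have [[i ti]|nt] := pselect (exists i, t i = j).
      by exists i => i'; rewrite -ti => /(increasing_inj ltJ inct) ->.
    by exists 0%N => i ti; case: nt; exists i.
  exists (fun jq => e (nth 0%N s (r jq.1)) jq.2); rewrite liftE /=.
  suff -> : (fun pq : 'I_k * 'I_n => e (nth 0%N s (r (t pq.1))) pq.2) =
    flat (e \o (fun i : 'I_k => nth 0%N s i)) by [].
  by apply/funext => -[i q]; rewrite /flat /= (rP _ i).
pose a' j q := a (j, q).
have a'P k t psi : increasing lt t -> large k psi ->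
    sat psi (vjoin (flat (a' \o t)) p).
  by move=> inct lg; have /liftE := aP _ (ex_intro _ k (ex_intro _ t
    (ex_intro _ psi (And3 inct lg erefl)))).
exists a'; split=> [k psi ePsi t inct|A Ap k phi s t incs inct].
  apply: a'P => //; apply: itU_mono (itU_sorted U_large k) => s sk ss.
  apply: ePsi => i j ij; apply: (sorted_ltn_nth ltn_trans) => //;
  by rewrite inE sk.
have /choice[r rP] : forall c : A, exists z, p z = val c.
  by move=> c; have [z _ pz] := Ap _ (set_valP c); exists z.
pose psi := formula_map (vjoin inl (inr \o r)) phi.
have psiE v : sat psi (vjoin v p) <-> sat phi (vjoin v val).
  rewrite sat_map; suff -> : vjoin v p \o vjoin inl (inr \o r) = vjoin v val by [].
  by apply/funext => -[//|c]; exact: rP.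
have [lg|/itU_not nlg] := pselect (large _ psi).
  by split=> _; apply/psiE; exact: a'P.
have {}nlg : large _ (Not psi) by [].
by split=> /psiE h; [case: (a'P _ _ _ incs nlg h)|case: (a'P _ _ _ inct nlg h)].
Qed.

(** Indiscernibility of [bs] over [e] is a scheme of formulas about increasing tuples of [e] with
    parameters from [bs], and [EM_over] carries each of them to [a]. So a witness of dividing over
    [e] also works over [a]. *)
Lemma EM_dividing {J : Type} {n m} (lt : J -> J -> Prop) (j0 : J)
    (bs : nat -> tup C m) (e : nat -> tup C n) (a : J -> tup C n) :
  linear_order lt -> EM_over lt (flat bs) e a ->
  indiscernible ltN bs (seq_set e) -> indiscernible ltN bs (seq_set a).
Proof.
move=> ltJ EM ibs k phi s1 s2 inc1 inc2.
have [rep repE] := seq_set_rep a.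
pose chi := formula_map (vjoin inl (inr \o rep)) phi.
have chiE y : sat chi (vjoin y (flat a)) <-> sat phi (vjoin y val).
  rewrite sat_map.
  suff -> : vjoin y (flat a) \o vjoin inl (inr \o rep) = vjoin y val by [].
  by apply/funext => -[//|c]; exact: repE.
have [w wf wP] := row_normal_form (C := C) chi.
(* Adding [j0] keeps the tuple nonempty, so that a default index [i0] exists. *)
have [l [t [inct tE]]] : exists k (s : 'I_k -> J), increasing lt s /\
    range s = w `|` [set j0].
  by apply: finite_set_increasing => //; rewrite finite_setU.
have [i0 _ _] : range t j0 by rewrite tE; right.
have [|chi' chi'E] := wP _ t i0; first by rewrite tE; exact: subsetUl.
pose ren (s : 'I_k -> nat) : 'I_k * 'I_m + 'I_l * 'I_n -> 'I_l * 'I_n + nat * 'I_m :=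
  vjoin (fun pq => inr (s pq.1, pq.2)) inl.
have renE s v : vjoin v (flat bs) \o ren s = vjoin (flat (bs \o s)) v.
  by rewrite vjoin_comp.
have := EM _ (Iff (formula_map (ren s1) chi') (formula_map (ren s2) chi')) _ _ inct.
rewrite sat_Iff !sat_map !renE -!(chi'E _ a)// !chiE; apply=> u incu.
rewrite sat_Iff !sat_map !renE.
pose psi : formula L ('I_k * 'I_m + seq_set e) :=
  formula_map (vjoin inl (fun pq => inr (entry e (u pq.1) pq.2))) chi'.
by have := ibs _ psi _ _ inc1 inc2; rewrite !sat_map !vjoin_comp.
Qed.

(** That some realization of [phi] can stand at place [l] of a tuple while preserving [psi] is a
    first-order statement with parameters [p]. It holds along [e], so it transfers to [a], and
    compactness yields one [c] that fills the place [t] with respect to all formulas. *)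
Lemma EM_filler {P J : Type} {n m} (lt : J -> J -> Prop) (p : P -> C)
    (d : tup C m) (phi : formula L ('I_n + 'I_m))
    (e : nat -> tup C n) (a : J -> tup C n) (t : J) :
  linear_order lt -> le_continuum J -> EM_over lt p e a ->
  range d `<=` range p -> indiscernible ltN e set0 ->
  (forall k (psi : formula L ('I_k * 'I_n)) (s : 'I_k -> nat) (l : 'I_k),
    increasing ltN s -> sat psi (flat (e \o s)) ->
    exists x, sat phi (vjoin x d) /\ sat psi (flat (replace (e \o s) l x))) ->
  exists c, sat phi (vjoin c d) /\ forall D : formula L (J * 'I_n),
    sat D (flat a) <-> sat D (flat (replace a t c)).
Proof.
move=> ltJ cJ EM dp ie He.
have /choice[z zE] : forall i, exists z, p z = d i.
  by move=> i; have [y _ py] := dp (d i) (ex_intro2 _ _ i I erefl); exists y.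
pose phi' : formula L ('I_n + (J * 'I_n + 'I_m)) :=
  formula_map (vjoin inl (inr \o inr)) phi.
pose ren (jq : J * 'I_n) : 'I_n + (J * 'I_n + 'I_m) :=
  if `[< jq.1 = t >] then inl jq.2 else inr (inl jq).
pose q := vjoin (flat a) d.
have phi'E x : sat phi' (vjoin x q) <-> sat phi (vjoin x d).
  by rewrite sat_map vjoin_comp.
have renE x : vjoin x q \o ren = flat (replace a t x).
  by apply/funext => -[j i]; rewrite /= /ren /flat /replace /=; case: ifP.
pose Sigma : set (formula L ('I_n + (J * 'I_n + 'I_m))) := [set th | exists2 D,
  sat D (flat a) & th = And phi' (formula_map ren D)].
have [||||_ [D aD ->]|c cP] := @compactness _ _ _ kC satC _ _ q Sigma.
- exact: le_continuum_count.
- apply: le_continuum_sum; last exact: le_continuum_count.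
  by apply: le_continuum_prod => //; exact: le_continuum_count.
- by exists (And phi' (formula_map ren Top)), Top.
- move=> _ _ [D1 aD1 ->] [D2 aD2 ->].
  exists (And phi' (formula_map ren (And D1 D2))).
    by exists (And D1 D2) => //; rewrite sat_And.
  by move=> v; rewrite !(sat_And, sat_map); tauto.
- pose D' : formula L (void + J * 'I_n) := formula_map inr D.
  have [w wf wP] := row_normal_form (C := C) D'.
  have [k [s [incs sE]]] : exists k (s : 'I_k -> J), increasing lt s /\
      range s = w `|` [set t].
    by apply: finite_set_increasing => //; rewrite finite_setU.
  have [l _ sl] : range s t by rewrite sE; right.
  have [|chi chiE] := wP _ s l; first by rewrite sE; exact: subsetUl.
  pose psi : formula L ('I_k * 'I_n) := formula_map (vjoin (of_void _) id) chi.
  have psiE (b : J -> tup C n) (g : 'I_k -> tup C n) :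
      (forall i, w (s i) -> g i = b (s i)) -> sat D (flat b) <-> sat psi (flat g).
    move=> /(chiE (of_void C)) h.
    have -> : sat D (flat b) <-> sat D' (vjoin (of_void C) (flat b)).
      by rewrite sat_map.
    rewrite h sat_map vjoin_comp.
    by suff -> : flat g \o of_void _ = of_void C by []; apply/funext => -[].
  clearbody psi.
  (* If [psi] failed on one increasing tuple of [e], its negation would hold on all of them by
     indiscernibility and would pass to [a], where [psi] is true. *)
  have ePsi s' : increasing ltN s' -> sat psi (flat (e \o s')).
    move=> incs'; apply: contrapT => nPsi.
    have := EM _ (Not (formula_map inl psi)) _ _ incs.
    rewrite /= sat_map -(psiE a)//; apply=> // s'' incs''.
    rewrite /= sat_map => h; apply: nPsi.
    have := ie _ (formula_map inl psi) _ _ incs'' incs'.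
    by rewrite !sat_map => -[h' _]; exact: h' h.
  pose rphi : 'I_n + 'I_m -> ('I_k * 'I_n + P) + 'I_n := vjoin inr (inl \o inr \o z).
  pose rpsi (iq : 'I_k * 'I_n) : ('I_k * 'I_n + P) + 'I_n :=
    if `[< iq.1 = l >] then inr iq.2 else inl (inl iq).
  have [Th ThE] := @ex_definable _ C _ _
    (And (formula_map rphi phi) (formula_map rpsi psi)).
  have {}ThE g : sat Th (vjoin (flat g) p) <->
      exists x, sat phi (vjoin x d) /\ sat psi (flat (replace g l x)).
    rewrite ThE.
    have E1 x : vjoin (vjoin (flat g) p) x \o rphi = vjoin x d.
      by apply/funext => -[//|i] /=; rewrite zE.
    have E2 x : vjoin (vjoin (flat g) p) x \o rpsi = flat (replace g l x).
      by apply/funext => -[j i]; rewrite /= /rpsi /flat /replace /=; case: ifP.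
    by split=> -[x] h; exists x; move: h; rewrite sat_And !sat_map E1 E2.
  have /ThE[x [xphi xpsi]] : sat Th (vjoin (flat (a \o s)) p).
    by apply: EM incs => s' incs'; apply/ThE; apply: He => //; exact: ePsi.
  exists x; rewrite sat_And phi'E sat_map renE; split=> //.
  rewrite (psiE _ (replace (a \o s) l x))// => i _; rewrite /replace /=.
  have [->|il] := pselect (i = l); first by rewrite !asboolT.
  rewrite !asboolF// => sit; apply: il.
  by apply: (increasing_inj ltJ incs); rewrite sit sl.
have cD D : sat D (flat a) -> sat D (flat (replace a t c)).
  move=> aD; have /sat_And[_] : sat (And phi' (formula_map ren D)) (vjoin c q).
    by apply: cP; exists D.
  by rewrite sat_map renE.
exists c; split=> [|D].
  have /sat_And[/phi'E//] : sat (And phi' (formula_map ren Top)) (vjoin c q).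
  by apply: cP; exists Top.
split=> [/cD//|aD]; apply: contrapT => /(cD (Not D)) /=; exact.
Qed.

Lemma indiscernible_same_type {J : Type} {n} (lt : J -> J -> Prop)
    (a a' : J -> tup C n) :
  (forall D : formula L (J * 'I_n), sat D (flat a) <-> sat D (flat a')) ->
  indiscernible lt a set0 -> indiscernible lt a' set0.
Proof.
move=> aa' ia k phi s t incs inct.
pose ren (s : 'I_k -> J) : 'I_k * 'I_n + (set0 : set C) -> J * 'I_n :=
  vjoin (fun pq => (s pq.1, pq.2)) (fun c => False_rect _ (set_valP c)).
have renE (b : J -> tup C n) u : sat (formula_map (ren u) phi) (flat b) <->
    sat phi (vjoin (fun pq => b (u pq.1) pq.2) val).
  rewrite sat_map; suff -> : flat b \o ren u =
    vjoin (fun pq => b (u pq.1) pq.2) val by [].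
  by apply/funext => -[//|c]; case: (set_valP c).
rewrite -(renE a' s) -(renE a' t) -!aa' !renE; exact: ia.
Qed.

Lemma indiscernible_sub {J : Type} {n} (lt : J -> J -> Prop)
    (a : J -> tup C n) (A B : set C) :
  A `<=` B -> indiscernible lt a B -> indiscernible lt a A.
Proof.
move=> AB ia k phi s t incs inct.
have := ia k (formula_map (vjoin inl (inr \o param_incl AB)) phi) s t incs inct.
by rewrite !sat_map !vjoin_comp.
Qed.

End Stretching.

(** * A finitely additive measure defined on all sets of reals *)

Section FinitelyAdditive.
Local Open Scope classical_set_scope.
Local Open Scope ring_scope.
Context {R : realType}.
Import numFieldNormedType.Exports.

Lemma fmap_ultra {S T : Type} (f : S -> T) (U : set_system S) :
  UltraFilter U -> UltraFilter (f @ U).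
Proof.
move=> UU; split=> [|G GG UG].
  exact: fmap_proper_filter.
apply/seteqP; split=> // A GA.
have [//|UnA] := in_ultra_setVsetC (f @^-1` A) UU.
have GnA : G (~` A) by apply: UG.
by have [x []] := filter_ex (filterI GA GnA).
Qed.

(** [P] is left free at [l%:R = y], so that the count serves both strict and weak inequalities. *)
Lemma count_below (P : nat -> bool) (y : R) N :
  0 <= y <= N%:R ->
  (forall l, l%:R < y -> P l) -> (forall l, y < l%:R -> ~~ P l) ->
  y <= \sum_(l < N) (P l)%:R <= y + 1.
Proof.
move=> + Pl Pg; elim: N => [|N IH] /andP[y0 yN].
  by rewrite big_ord0; apply/andP; split=> //; lra.
rewrite big_ord_recr /=.
have [yN'|Ny] := ltP y N%:R.
  by rewrite (negbTE (Pg _ yN')) addr0; apply: IH; rewrite y0 ltW.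
have -> : \sum_(l < N) (P l)%:R = N%:R :> R.
  rewrite -[RHS]mulr1n -[N in RHS]card_ord -sumr_const; apply: eq_bigr => l _.
  by rewrite Pl // (lt_le_trans _ Ny)// ltr_nat.
have : N%:R < y -> P N by exact: Pl.
rewrite -natr1 in yN; case: (P N) => /= h.
  by apply/andP; split; lra.
have : ~ N%:R < y by move=> /h.
by move/negP; rewrite -leNgt => h'; apply/andP; split; lra.
Qed.

Let density (S : set R) (N : nat) : R :=
  (\sum_(l < N.+1) (`[< S (l%:R / N.+1%:R) >])%:R) / N.+1%:R.

Let density_itv (S : set R) N : 0 <= density S N <= 1.
Proof.
rewrite divr_ge0 ?sumr_ge0//= ler_pdivrMr ?ltr0n// mul1r.
rewrite -[leRHS]mulr1n -[N.+1 in leRHS]card_ord -sumr_const ler_sum// => l _.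
by case: `[< _ >].
Qed.

Let cvg_density (f : nat -> R) (x : R) :
  (forall N, `|f N - x| <= N.+1%:R^-1) -> f @ \oo --> x.
Proof.
move=> fx; apply/cvgrPdist_lt => e e0.
near=> N; rewrite distrC (le_lt_trans (fx N))//.
near: N; exact: (near_infty_natSinv_lt (PosNum e0)).
Unshelve. all: by end_near. Qed.

(* The limit along an ultrafilter of the proportions of points of the grids
   [{l / N : l < N}] that lie in the set. *)
Lemma ex_finitely_additive : exists m : set R -> R,
  [/\ forall S, 0 <= m S, m `[0, 1]%classic = 1,
      forall S S', S `&` S' = set0 -> m (S `|` S') = m S + m S',
      forall x, m [set x] = 0 &
      forall u v : R, 0 <= u -> u <= v -> v <= 1 -> m `]u, v[%classic = v - u].
Proof.
(* Ordinary limits are limits along the refining ultrafilter [U], and every sequence in the compact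
   interval [0, 1] converges along it. *)
have [U [UU ooU]] := ultraFilterLemma (F := \oo) _.
have finer f (x : R) : f @ \oo --> x -> f @ U --> x.
  by move=> fx A /fx; exact: ooU.
have uniq_lim f (x y : R) : f @ U --> x -> f @ U --> y -> x = y.
  by apply: cvg_unique; exact: norm_hausdorff.
have /choice[m mP] : forall S, exists l : R, density S @ U --> l /\ 0 <= l.
  move=> S; have := @segment_compact R 0 1; rewrite compact_ultra => /(_ (density S @ U)).
  case; first exact: fmap_ultra.
    change (U (density S @^-1` `[0, 1]%classic)).
    suff -> : density S @^-1` `[0, 1]%classic = setT by exact: filterT.
    by apply/seteqP; split=> // N _; rewrite /= in_itv /=; exact: density_itv.
  by move=> l [/= ]; rewrite in_itv /= => /andP[l0 _] ?; exists l.
exists m; split.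
- by move=> S; exact: (mP S).2.
- apply: (uniq_lim _ _ _ (mP _).1); apply: finer; apply: cvg_density => N.
  suff -> : density `[0, 1]%classic N = 1 by rewrite subrr normr0 invr_ge0.
  apply: (canLR (mulfK _)); first by rewrite pnatr_eq0.
  rewrite mul1r -[RHS]mulr1n -[N.+1 in RHS]card_ord -sumr_const.
  apply: eq_bigr => l _; rewrite asboolT//= in_itv /= divr_ge0//=.
  by rewrite ler_pdivrMr ?ltr0n// mul1r ler_nat ltnW.
- move=> S S' SS'; apply: (uniq_lim _ _ _ (mP _).1).
  have -> : density (S `|` S') = density S + density S'.
    apply/funext => N; rewrite /density /= [RHS]/= -[RHS]mulrDl -big_split /=.
    congr (_ / _); apply: eq_bigr => l _; set x := _ / _.
    have : ~ (S x /\ S' x).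
      by move=> SSx; have : (S `&` S') x by []; rewrite SS'.
    rewrite asbool_or; case: asboolP; case: asboolP => /= ? ? h;
    by rewrite ?addr0 ?add0r//; case: h.
  by apply: cvgD; [exact: (mP S).1|exact: (mP S').1].
- move=> x; apply: (uniq_lim _ _ _ (mP _).1); apply: finer; apply: cvg_density => N.
  have [/andP[d0 _]] := density_itv [set x] N.
  rewrite subr0 ger0_norm// /density ler_pdivrMr ?ltr0n// mulVf ?pnatr_eq0//.
  have [[l lx]|nl] := pselect (exists l : 'I_N.+1, l%:R / N.+1%:R = x).
    rewrite (bigD1 l)//= big1 ?addr0; first by case: `[< _ >].
    move=> l' l'l; rewrite asboolF// => l'x; move/eqP: l'l; apply; apply/val_inj.
    apply/eqP; rewrite -(eqr_nat R); apply/eqP; apply: (mulIf (x := N.+1%:R^-1)).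
      by rewrite invr_eq0 pnatr_eq0.
    by rewrite lx.
  rewrite big1// => l _; rewrite asboolF// => lx; apply: nl; by exists l.
- move=> u v u0 uv v1; apply: (uniq_lim _ _ _ (mP _).1).
  apply: finer; apply: cvg_density => N.
  have N0 : 0 < N.+1%:R :> R by rewrite ltr0n.
  have [uv'|vu] := ltP u v; last first.
    have -> : v = u by apply/le_anti; rewrite uv vu.
    rewrite subrr subr0 /density big1 ?mul0r ?normr0 ?invr_ge0// => l _.
    by rewrite asboolF//= in_itv /= => /andP[/lt_trans h /h]; rewrite ltxx.
  (* The grid points in the open interval are those with [l < v * N.+1] minus those with
     [l <= u * N.+1]. Both counts err upwards by at most 1, so their difference errs by at most
     1. *)
  have /andP[a1 a2] : v * N.+1%:R <= \sum_(l < N.+1) ((l%:R : R) < v * N.+1%:R)%R%:R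
      <= v * N.+1%:R + 1.
    apply: (count_below (P := fun l => l%:R < v * N.+1%:R)).
    - apply/andP; split; [apply: mulr_ge0|apply: ler_piMl] => //; exact: le_trans uv.
    - by [].
    - by move=> l h; rewrite -leNgt ltW.
  have /andP[b1 b2] : u * N.+1%:R <= \sum_(l < N.+1) ((l%:R : R) <= u * N.+1%:R)%R%:R
      <= u * N.+1%:R + 1.
    apply: (count_below (P := fun l => l%:R <= u * N.+1%:R)).
    - apply/andP; split; [apply: mulr_ge0|apply: ler_piMl] => //; exact: le_trans v1.
    - by move=> l /ltW.
    - by move=> l; rewrite -ltNge.
  have -> : density `]u, v[%classic N = (\sum_(l < N.+1) ((l%:R : R) < v * N.+1%:R)%R%:R -
      \sum_(l < N.+1) ((l%:R : R) <= u * N.+1%:R)%R%:R) / N.+1%:R.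
    congr (_ / _); rewrite -sumrB; apply: eq_bigr => l _.
    rewrite -ltr_pdivrMr// -ler_pdivrMr//; set x := _ / _.
    have -> : `[< `]u, v[%classic x >] = (u < x < v).
      by apply/asboolP/idP; rewrite /= in_itv.
    have [xu|ux] := leP x u; first by rewrite (le_lt_trans xu uv') subrr.
    by rewrite subr0.
  rewrite -[leRHS]mul1r -{1}(mulfK (lt0r_neq0 N0) (v - u)) -mulrBl normrM.
  rewrite [`|_^-1|]gtr0_norm ?invr_gt0//.
  apply: ler_wpM2r; first by rewrite invr_ge0 ltW.
  by rewrite ler_norml mulrBl; apply/andP; split; lra.
Qed.

End FinitelyAdditive.

(** * Agreement with Lebesgue measure on finite unions of intervals *)

Section GapConstant.
Local Open Scope classical_set_scope.
Local Open Scope ring_scope.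
Context {R : realType}.

Definition len (S : set R) : R := fine (lebesgue_measure S).

Lemma lebesgue_fin (S : set R) : measurable S -> S `<=` `[0, 1]%classic ->
  lebesgue_measure S \is a fin_num.
Proof.
move=> mS S01; rewrite ge0_fin_numE//.
apply: (@le_lt_trans _ _ (lebesgue_measure `[(0 : R), 1]%classic)).
  by apply: le_measure => //; rewrite inE.
by rewrite lebesgue_measure_itv /= lte_fin ltr01 -EFinB ltry.
Qed.

Lemma len_ge0 (S : set R) : 0 <= len S.
Proof. exact: fine_ge0. Qed.

Lemma lenU (S S' : set R) : measurable S -> measurable S' ->
  S `<=` `[0, 1]%classic -> S' `<=` `[0, 1]%classic -> S `&` S' = set0 ->
  len (S `|` S') = len S + len S'.
Proof.
move=> mS mS' s s' SS'; rewrite /len measureU// fineD//; exact: lebesgue_fin.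
Qed.

Lemma le_len (S S' : set R) : measurable S -> measurable S' ->
  S' `<=` `[0, 1]%classic -> S `<=` S' -> len S <= len S'.
Proof.
move=> mS mS' s' SS'; apply: fine_le.
- by apply: lebesgue_fin => //; exact: subset_trans s'.
- exact: lebesgue_fin.
- by apply: le_measure => //; rewrite inE.
Qed.

Lemma len_itv (u v : R) : u <= v -> len `]u, v[%classic = v - u.
Proof.
move=> uv; rewrite /len lebesgue_measure_itv /= lte_fin.
by case: ltP => //= vu; apply/eqP; rewrite eq_sym subr_eq0; apply/eqP/le_anti; rewrite vu.
Qed.

Lemma len_set1 (x : R) : len [set x] = 0.
Proof. by rewrite /len lebesgue_measure_set1. Qed.

Lemma len_set0 : len set0 = 0.
Proof. by rewrite /len measure0. Qed.

Context {m : set R -> R}.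
Hypothesis m_add : forall S S', S `&` S' = set0 -> m (S `|` S') = m S + m S'.
Hypothesis m_set1 : forall x, m [set x] = 0.
Hypothesis m_itv : forall u v : R, 0 <= u -> u <= v -> v <= 1 -> m `]u, v[%classic = v - u.

Lemma m_set0 : m set0 = 0.
Proof.
have := m_add (setI0 (set0 : set R)); rewrite setU0 => /eqP.
by rewrite -subr_eq0 opprD addrA subrr add0r oppr_eq0 => /eqP.
Qed.

Lemma m_finite (S : set R) : finite_set S -> m S = 0.
Proof.
move=> /finite_seqP[s]; elim: s S => [|x s IH] S ->.
  by rewrite (_ : [set` [::]] = set0) ?m_set0//; apply/seteqP; split.
have [xs|xs] := boolP (x \in s).
  apply: IH; apply/seteqP; split=> y /=; rewrite inE; last by move=> ->; rewrite orbT.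
  by move=> /orP[/eqP ->|].
have -> : [set` x :: s] = [set x] `|` [set` s].
  apply/seteqP; split=> y /=; rewrite inE; first by move=> /orP[/eqP|]; [left|right].
  by move=> [->|->]; rewrite ?eqxx ?orbT.
rewrite m_add ?m_set1 ?add0r; first exact: IH.
by apply/seteqP; split=> // y /= [-> ]; apply/negP.
Qed.

Lemma m_eq_finite (S S' w : set R) : finite_set w ->
  (forall x, ~ w x -> (S x <-> S' x)) -> m S = m S'.
Proof.
move=> wf SS'.
have split_w X : m X = m (X `\` w).
  rewrite -{1}(setUIDK X w) m_add.
    by rewrite m_finite ?add0r//; exact: finite_setIr.
  by apply/seteqP; split=> // x [[? ?] []].
rewrite (split_w S) (split_w S'); congr m; apply/seteqP.
by split=> x [/= Sx nwx]; split=> //; apply/(SS' x nwx).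
Qed.

Definition m_regular (S : set R) :=
  [/\ measurable S, S `<=` `[0, 1]%classic & m S = len S].

Lemma m_regularU (S S' : set R) : S `&` S' = set0 ->
  m_regular S -> m_regular S' -> m_regular (S `|` S').
Proof.
move=> SS' [mS s mlS] [mS' s' mlS']; split.
- exact: measurableU.
- by move=> x [/s|/s'].
- by rewrite m_add// lenU// mlS mlS'.
Qed.

Lemma m_regular0 : m_regular set0.
Proof. by split=> //; rewrite m_set0 len_set0. Qed.

Lemma m_regularI1 (S : set R) x : 0 <= x <= 1 -> m_regular (S `&` [set x]).
Proof.
move=> x01; have [Sx|nSx] := pselect (S x).
  have -> : S `&` [set x] = [set x].
    by apply/seteqP; split=> y /= => [[]|->].
  split; first exact: measurable_set1.
    by move=> y /= ->; rewrite in_itv.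
  by rewrite m_set1 len_set1.
have -> : S `&` [set x] = set0; last exact: m_regular0.
by apply/seteqP; split=> // y [+ yx]; rewrite yx.
Qed.

(** Induction on [w]: a point inside the interval splits it into two open intervals and a singleton,
    a point outside imposes nothing, and with no points left [S] is empty or the whole interval. So
    [S] is a finite union of intervals and points, on which both measures agree. *)
Lemma gap_constant_open (w : seq R) (u v : R) (S : set R) :
  0 <= u -> u <= v -> v <= 1 -> S `<=` `]u, v[%classic ->
  (forall x y, u < x -> x < y -> y < v -> (forall z, z \in w -> z < x \/ y < z) ->
    (S x <-> S y)) ->
  m_regular S.
Proof.
elim: w u v S => [|p w IH] u v S u0 uv v1 Suv Sgap.
  have [[x Sx]|nS] := pselect (S !=set0); last first.
    have -> : S = set0; last exact: m_regular0.
    by apply/seteqP; split=> // x Sx; apply: nS; exists x.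
  have -> : S = `]u, v[%classic.
    apply/seteqP; split=> // y /=; rewrite in_itv /= => /andP[uy yv].
    have := Suv _ Sx; rewrite /= in_itv /= => /andP[ux xv].
    by have [xy|yx|<-//] := ltgtP x y; [apply/(Sgap x y)|apply/(Sgap y x)].
  split; first exact: measurable_itv.
    move=> y; rewrite /= !in_itv /= => /andP[uy yv].
    by apply/andP; split; lra.
  by rewrite m_itv// len_itv.
have [/andP[up pv]|npuv] := boolP (u < p < v); last first.
  apply: (IH u v) => // x y ux xy yv zw; apply: Sgap => // z.
  rewrite inE => /orP[/eqP ->|/zw//].
  have [px|xp] := ltP p x; first by left.
  right; rewrite ltNge; apply/negP => py; move/negP: npuv; apply.
  by rewrite (lt_le_trans ux xp) (le_lt_trans py yv).
have -> : S = (S `&` `]u, p[%classic) `|` ((S `&` [set p]) `|` (S `&` `]p, v[%classic)).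
  apply/seteqP; split=> x; last by move=> [[]|[[]|[]]].
  move=> Sx; have := Suv _ Sx; rewrite /= in_itv /= => /andP[ux xv].
  have [xp|px|xp] := ltgtP x p.
  - by left; split=> //=; rewrite in_itv /= ux.
  - by right; right; split=> //=; rewrite in_itv /= px.
  - by right; left.
apply: m_regularU.
- apply/seteqP; split=> // x /= [[_]]; rewrite in_itv /= => /andP[_ xp].
  by move=> [[_ xp']|[_]]; [rewrite xp' ltxx in xp|rewrite in_itv /= ltNge (ltW xp)].
- apply: (IH u p); [by []|exact: ltW|lra|exact: subIsetr|].
  move=> x y ux xy yp zw.
  have xup : `]u, p[%classic x by rewrite /= in_itv /= ux (lt_trans xy).
  have yup : `]u, p[%classic y by rewrite /= in_itv /= yp (lt_trans ux).
  have [h1 h2] : S x <-> S y.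
    apply: Sgap => //; first exact: lt_trans pv.
    by move=> z; rewrite inE => /orP[/eqP ->|/zw//]; right.
  by split=> -[? _]; split=> //; [exact: h1|exact: h2].
apply: m_regularU.
- by apply/seteqP; split=> // x /= [[_ ->] [_]]; rewrite in_itv /= ltxx.
- by apply: m_regularI1; apply/andP; split; lra.
apply: (IH p v); [lra|exact: ltW|by []|exact: subIsetr|].
move=> x y px xy yv zw.
have xpv : `]p, v[%classic x by rewrite /= in_itv /= px (lt_trans xy).
have ypv : `]p, v[%classic y by rewrite /= in_itv /= yv (lt_trans px).
have [h1 h2] : S x <-> S y.
  apply: Sgap => //; first exact: lt_trans px.
  by move=> z; rewrite inE => /orP[/eqP ->|/zw//]; left.
by split=> -[? _]; split=> //; [exact: h1|exact: h2].
Qed.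

Lemma gap_constant_regular (w S : set R) : finite_set w -> S `<=` `[0, 1]%classic ->
  (forall x y, 0 < x -> x < y -> y < 1 -> (forall z, w z -> z < x \/ y < z) ->
    (S x <-> S y)) ->
  m_regular S.
Proof.
move=> /finite_seqP[s ->] S01 Sgap.
have -> : S = (S `&` [set 0]) `|` ((S `&` [set 1]) `|` (S `&` `]0, 1[%classic)).
  apply/seteqP; split=> x; last by move=> [[]|[[]|[]]].
  move=> Sx; have := S01 _ Sx; rewrite /= in_itv /= => /andP[].
  rewrite le_eqVlt => /orP[/eqP x0 _|x0]; first by left; split=> //=.
  rewrite le_eqVlt => /orP[/eqP x1|x1]; first by right; left; split.
  by right; right; split=> //=; rewrite in_itv /= x0.
apply: m_regularU.
- apply/seteqP; split=> // x /= [[_ ->] [[_ /eqP]|[_]]].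
    by rewrite eq_sym oner_eq0.
  by rewrite in_itv /= ltxx.
- by apply: m_regularI1; rewrite lexx ler01.
apply: m_regularU.
- by apply/seteqP; split=> // x /= [[_ ->] [_]]; rewrite in_itv /= ltxx andbF.
- by apply: m_regularI1; rewrite lexx ler01.
apply: (@gap_constant_open s 0 1); [by []|exact: ler01|by []|by move=> x []|].
move=> x y x0 xy y1 zs.
have x01 : `]0, 1[%classic x by rewrite /= in_itv /= x0 (lt_trans xy).
have y01 : `]0, 1[%classic y by rewrite /= in_itv /= y1 (lt_trans x0).
have [h1 h2] := Sgap _ _ x0 xy y1 zs.
by split=> -[? _]; split=> //; [exact: h1|exact: h2].
Qed.

End GapConstant.

(** * Linear orders used as index sets *)

Section Orders.
Local Open Scope classical_set_scope.

Lemma lt_sum_linear {J1 J2 : Type} (lt1 : J1 -> J1 -> Prop) (lt2 : J2 -> J2 -> Prop) :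
  linear_order lt1 -> linear_order lt2 -> linear_order (lt_sum lt1 lt2).
Proof.
move=> [irr1 tr1 tot1] [irr2 tr2 tot2]; split.
- by move=> [i|i]; [exact: irr1|exact: irr2].
- by move=> [i|i] [j|j] [k|k] //=; [exact: tr1|exact: tr2].
- move=> [i|i] [j|j] /=.
  + by have [?|->|?] := tot1 i j; [apply: Or31|apply: Or32|apply: Or33].
  + exact: Or31.
  + exact: Or33.
  + by have [?|->|?] := tot2 i j; [apply: Or31|apply: Or32|apply: Or33].
Qed.

Lemma lt_point_linear : linear_order lt_point.
Proof. by split=> // -[] []; exact: Or32. Qed.

Lemma lt_unit_linear (R : realType) : linear_order (@lt_unit R).
Proof.
split; rewrite /lt_unit.
- by move=> i; rewrite ltxx.
- by move=> i j k; exact: lt_trans.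
- move=> i j; have [ij|ij|/val_inj ij] := ltgtP (val i) (val j).
  + exact: Or31.
  + exact: Or33.
  + exact: Or32.
Qed.

Lemma lt_rat_linear : linear_order (fun x y : rat => (x < y)%R : Prop).
Proof.
split.
- by move=> x; rewrite ltxx.
- by move=> x y z; exact: lt_trans.
- by move=> x y; have [?|?|->] := ltgtP x y; [exact: Or31|exact: Or33|exact: Or32].
Qed.

Lemma ex_monotone_seq {J : Type} (lt : J -> J -> Prop) :
  (forall i j k, lt i j -> lt j k -> lt i k) -> inhabited J ->
  (forall i, exists j, lt i j) ->
  exists f : nat -> J, forall p q, (p < q)%N -> lt (f p) (f q).
Proof.
move=> tr [j0] nl; have [f [_ fS]] := dependent_choice (fun i => cid (nl i)) j0.
exists f => p; elim=> // q IH; rewrite ltnS leq_eqVlt => /orP[/eqP <-//|/IH pq].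
exact: tr pq (fS q).
Qed.

End Orders.

(** * Traces of formulas on an indiscernible sequence *)

Section Traces.
Local Open Scope classical_set_scope.
Context {L : language} {C : structure L}.

Lemma holds_rep {J : Type} {n} (a : J -> tup C n) (D : formula_over n (seq_set a))
    (rep : seq_set a -> J * 'I_n) (x : tup C n) :
  (forall c, flat a (rep c) = val c) ->
  holds D x <-> sat (formula_map (vjoin inl (inr \o rep)) D) (vjoin x (flat a)).
Proof.
move=> repE; rewrite sat_map /holds.
suff -> : vjoin x (flat a) \o vjoin inl (inr \o rep) = vjoin x val by [].
by apply/funext => -[//|c]; exact: repE.
Qed.

(** Moving the index [i] to [i'] does not change the order type formed with the parameter indices of
    [D], so indiscernibility applies. Over [0, 1] this makes the trace of [D] a finite union of
    intervals and points. *)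
Lemma holds_gap {J : Type} {n} (lt : J -> J -> Prop) (a : J -> tup C n)
    (D : formula_over n (seq_set a)) :
  linear_order lt -> indiscernible lt a set0 ->
  exists2 w : set J, finite_set w & forall i i', lt i i' ->
    (forall j, w j -> lt j i \/ lt i' j) -> (holds D (a i) <-> holds D (a i')).
Proof.
move=> ltJ ia; have [irr tr _] := ltJ.
have [rep repE] := seq_set_rep a.
have [w wf wP] := row_normal_form (C := C) (formula_map (vjoin inl (inr \o rep)) D).
exists w => // i i' ii' wii'.
have [k [s [incs sE]]] : exists k (s : 'I_k -> J), increasing lt s /\
    range s = w `|` [set i].
  by apply: finite_set_increasing => //; rewrite finite_setU.
have [l _ sl] : range s i by rewrite sE; right.
have nwi : ~ w i.
  by move=> /wii'[/irr//|/(tr _ _ _ ii')/irr].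
have ws p : p <> l -> w (s p).
  move=> pl; have [//|spi] : (w `|` [set i]) (s p) by rewrite -sE; exists p.
  by case: pl; apply: (increasing_inj ltJ incs); rewrite sl.
have [|chi chiE] := wP _ s l; first by rewrite sE; exact: subsetUl.
pose psi : formula L ('I_k * 'I_n + (set0 : set C)) :=
  formula_map (vjoin (fun q => inl (l, q)) inl) chi.
pose s' := replace s l i'.
have DE u : (forall p, p <> l -> u p = s p) ->
    holds D (a (u l)) <-> sat psi (vjoin (flat (a \o u)) val).
  move=> us; rewrite (holds_rep D _ repE) (chiE _ _ (a \o u)).
    by rewrite sat_map vjoin_comp.
  by move=> p wsp; rewrite /= us// => pl; apply: nwi; rewrite -sl -pl.
have s'l : s' l = i' by exact: replace_eq.
rewrite -{1}sl -{1}s'l DE// DE; last by move=> p pl; exact: replace_neq.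
apply: ia => // p q pq; rewrite /s' /replace.
have [pl|pl] := pselect (p = l).
  rewrite asboolT// asboolF; last by move=> ql; rewrite pl ql ltnn in pq.
  have ql : q <> l by move=> ql; rewrite pl ql ltnn in pq.
  have := incs _ _ pq; rewrite pl sl => isq.
  by have [/(tr _ _ _ isq)/irr|] := wii' _ (ws _ ql).
rewrite asboolF//; have [ql|ql] := pselect (q = l).
  by rewrite asboolT//; apply: tr ii'; rewrite -sl -ql; exact: incs.
by rewrite asboolF//; exact: incs.
Qed.

(** At an index not occurring in the parameters of [D], the replacement affects the variable of [D]
    and none of its parameters. *)
Lemma holds_replace {J : Type} {n} (a : J -> tup C n)
    (D : formula_over n (seq_set a)) :
  exists2 w : set J, finite_set w & forall t c, ~ w t ->
    (forall D' : formula L (J * 'I_n),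
      sat D' (flat a) <-> sat D' (flat (replace a t c))) ->
    (holds D (a t) <-> holds D c).
Proof.
have [rep repE] := seq_set_rep a.
have [X Xf Xs] := @formula_support _ C _ D.
exists ((fst \o rep) @` (inr @^-1` X)).
  by apply: finite_image; apply: finite_preimage => // ? ? _ _ [].
move=> t c wt /(_ (formula_map (vjoin (fun q => (t, q)) rep) D)).
rewrite !sat_map !vjoin_comp => DD.
have -> : holds D (a t) <-> sat D (vjoin (flat a \o (fun q => (t, q))) (flat a \o rep)).
  by rewrite /holds; suff -> : flat a \o rep = val by []; exact/funext.
rewrite DD; apply: Xs => -[q _|c' /set_mem Xc'] /=.
  by rewrite /flat /= replace_eq.
rewrite /flat replace_neq; first exact: repE.
by move=> rt; apply: wt; exists c'.
Qed.

Context {R : realType}.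

Definition trace {n} (a : unit_interval R -> tup C n)
    (D : formula_over n (seq_set a)) : set R :=
  [set val i | i in [set i | holds D (a i)]].

Lemma trace_sub {n} (a : unit_interval R -> tup C n) (D : formula_over n (seq_set a)) :
  trace D `<=` `[0%R, 1%R]%classic.
Proof. by move=> x [i _ <-]; exact: set_valP. Qed.

Lemma trace_val {n} (a : unit_interval R -> tup C n) (D : formula_over n (seq_set a)) i :
  trace D (val i) <-> holds D (a i).
Proof. by split=> [[j Dj /val_inj <-]|Di]//; exists i. Qed.

Local Open Scope ring_scope.

Lemma trace_regular {m : set R -> R} {n} (a : unit_interval R -> tup C n)
    (D : formula_over n (seq_set a)) :
  (forall S S', S `&` S' = set0 -> m (S `|` S') = m S + m S') ->
  (forall x, m [set x] = 0) ->
  (forall u v, 0 <= u -> u <= v -> v <= 1 -> m `]u, v[%classic = v - u) ->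
  indiscernible (@lt_unit R) a set0 -> m_regular (m := m) (trace D).
Proof.
move=> mA m1 mI ia; have [w wf wP] := holds_gap D (lt_unit_linear R) ia.
apply: (gap_constant_regular mA m1 mI (finite_image val wf)).
  exact: trace_sub.
move=> x y x0 xy y1 zw.
have xI : x \in `[0, 1]%classic by rewrite inE /= in_itv /=; apply/andP; split; lra.
have yI : y \in `[0, 1]%classic by rewrite inE /= in_itv /=; apply/andP; split; lra.
rewrite -[x]/(val (SigSub xI : unit_interval R)) -[y]/(val (SigSub yI : unit_interval R)).
rewrite !trace_val; apply: wP => // j wj.
by apply: zw; exists j.
Qed.

End Traces.

(** * From smoothness to the cut condition *)

Section SmoothToCut.
Local Open Scope classical_set_scope.
Local Open Scope ring_scope.
Context {R : realType} {L : language} {kappa : Type} {C : structure L}.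
Hypothesis kC : small kappa [set: set nat].
Hypothesis satC : saturated kappa C.

Lemma filled_not_smooth {n m} (a : unit_interval R -> tup C n) (d : tup C m)
    (phi : formula L ('I_n + 'I_m)) :
  indiscernible (@lt_unit R) a set0 ->
  (forall t, exists c, sat phi (vjoin c d) /\
    forall D : formula L (unit_interval R * 'I_n),
      sat D (flat a) <-> sat D (flat (replace a t c))) ->
  NTP2_smooth kappa (average_measure a) -> ~ divides phi d (seq_set a).
Proof.
move=> ia /choice[c cP] smooth div.
have [mu [mu0 mu01 muA mu1 muI]] := @ex_finitely_additive R.
pose B := seq_set a `|` range d.
have AB : seq_set a `<=` B by move=> x; left.
have dB i : B (d i) by right; exists i.
pose b i : B := SigSub (mem_set (dB i)).
(* The push-forward of [mu] along [c]. It extends the average measure because, for each [D] over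
   [a], the truth of [D] at [c t] and at [a t] agrees for all but finitely many [t], and [mu]
   ignores finite sets. *)
pose nu (D : formula_over n B) : R := mu [set val t | t in [set t | holds D (c t)]].
have smallB : small kappa B.
  apply: (@le_continuum_small _ _ _ _ (vjoin (flat a) d)) => //.
    apply: le_continuum_sum; last exact: le_continuum_count.
    apply: le_continuum_prod; last exact: le_continuum_count.
    exact: le_continuum_inj val_inj (le_continuum_real R).
  move=> x [[j [i ->]]|[i _ <-]]; first by exists (inl (j, i)).
  by exists (inr i).
have nuK : keisler_measure nu.
  split.
  - move=> D D' DD'; congr mu; apply/seteqP.
    by split=> _ [t /DD' ? <-]; exists t.
  - by move=> D; exact: mu0.
  - rewrite -mu01; congr mu; apply/seteqP; split=> [_ [t _ <-]|x x01].
      exact: set_valP.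
    by exists (SigSub (mem_set x01)).
  - move=> D D' DD'; rewrite /nu -muA.
      congr mu; apply/seteqP; split=> [_ [t tD <-]|_ [[t tD <-]|[t tD <-]]].
      + have [Dt|nDt] := pselect (holds D (c t)); first by left; exists t.
        by right; exists t => //; exact: tD.
      + by exists t => // nD; case: nD.
      + by exists t.
    apply/seteqP; split=> // _ [[t tD <-] [t' t'D' /val_inj tt']].
    by apply: (DD' (c t)); split=> //; rewrite -tt'.
have nuE D : nu (formula_incl AB D) = average_measure a D.
  have [_ _ muD] := trace_regular D muA mu1 muI ia.
  have [w wf wP] := holds_replace D.
  have -> : average_measure a D = mu (trace D) by rewrite muD.
  apply: (m_eq_finite muA mu1 (finite_image val wf)) => x nwx.
  have inclE t : holds (formula_incl AB D) (c t) <-> holds D (c t).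
    by rewrite /holds sat_map vjoin_comp.
  have DE (t : unit_interval R) : x = val t ->
      holds (formula_incl AB D) (c t) <-> holds D (a t).
    move=> xt; rewrite inclE -(wP t)//; first by move=> wt; apply: nwx; exists t.
    exact: (cP t).2.
  by split=> -[t tD tx]; exists t => //; apply/DE.
have := smooth B AB nu smallB nuK nuE _ phi b div.
suff -> : nu (inst phi b) = 1 by move/eqP; rewrite oner_eq0.
rewrite -mu01; congr mu; apply/seteqP; split=> [_ [t _ <-]|x x01].
  exact: set_valP.
exists (SigSub (mem_set x01)) => //=.
by rewrite /holds sat_map vjoin_comp; exact: (cP _).1.
Qed.

Lemma cut_of_smooth {n m : nat} {J1 J2 : Type}
    (lt1 : J1 -> J1 -> Prop) (lt2 : J2 -> J2 -> Prop)
    (I1 : J1 -> tup C n) (I2 : J2 -> tup C n)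
    (d : tup C m) (b : tup C n) (phi : formula L ('I_n + 'I_m)) :
  (forall a : unit_interval R -> tup C n, indiscernible (@lt_unit R) a set0 ->
    NTP2_smooth kappa (average_measure a)) ->
  linear_order (lt_sum lt1 lt2) -> inhabited J1 -> inhabited J2 ->
  no_last lt1 -> no_first lt2 ->
  indiscernible (lt_sum lt1 lt2) (vjoin I1 I2) (range d) ->
  indiscernible (lt_sum (lt_sum lt1 lt_point) lt2)
    (vjoin (vjoin I1 (fun=> b)) I2) set0 ->
  divides phi d (seq_set (vjoin I1 I2)) ->
  ~ sat phi (vjoin b d).
Proof.
move=> smooth [irr tr tot] iJ1 iJ2 nl nf id ib [bs [ibs bs0 nbs]] phib.
have [f fI] : exists f : nat -> J1, forall p q, (p < q)%N -> lt1 (f p) (f q).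
  by apply: ex_monotone_seq => // i j k; exact: (tr (inl i) (inl j) (inl k)).
have [g gI] : exists g : nat -> J2, forall p q, (p < q)%N -> lt2 (g q) (g p).
  apply: (@ex_monotone_seq _ (fun i j => lt2 j i)) => // i j k ij jk.
  exact: (tr (inr k) (inr j) (inr i)).
pose e := I1 \o f.
have ie : indiscernible (fun i j : nat => (i < j)%N) e set0.
  move=> k psi s t incs inct.
  apply: (ib k psi (inl \o (inl \o (f \o s))) (inl \o (inl \o (f \o t)))).
    by move=> p q /incs /fI.
  by move=> p q /inct /fI.
have {}ibs : indiscernible (fun i j : nat => (i < j)%N) bs (seq_set e).
  apply: indiscernible_sub ibs => _ [j [i ->]].
  by exists (inl (f j)), i.
have cU : le_continuum (unit_interval R).
  exact: le_continuum_inj val_inj (le_continuum_real R).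
have [a [EM ia]] := stretching kC satC (flat bs) e (lt_unit_linear R) cU
  (le_continuum_count (nat * 'I_m)%type).
have i0 : unit_interval R.
  by exists 0; rewrite inE /= in_itv /= lexx ler01.
have ia0 : indiscernible (@lt_unit R) a set0 by exact: ia.
apply: (filled_not_smooth (d := d) (phi := phi) ia0 _ (smooth a ia0)); last first.
  by exists bs; split=> //; exact: (EM_dividing i0 (lt_unit_linear R) EM ibs).
move=> t; apply: (EM_filler kC satC (d := d) (phi := phi) t (lt_unit_linear R) cU EM _ ie).
  by move=> _ [i _ <-]; exists (0%N, i) => //; rewrite /flat /= bs0.
move=> k psi s l incs psis.
pose dd i : range d := SigSub (mem_set (ex_intro2 _ _ i I erefl : range d (d i))).
pose rphi : 'I_n + 'I_m -> ('I_k * 'I_n + range d) + 'I_n :=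
  vjoin inr (inl \o inr \o dd).
pose rpsi (iq : 'I_k * 'I_n) : ('I_k * 'I_n + range d) + 'I_n :=
  if `[< iq.1 = l >] then inr iq.2 else inl (inl iq).
have [Th ThE] := @ex_definable _ C _ _
  (And (formula_map rphi phi) (formula_map rpsi psi)).
have {}ThE h : sat Th (vjoin (flat h) val) <->
    exists x, sat phi (vjoin x d) /\ sat psi (flat (replace h l x)).
  rewrite ThE.
  have E1 x : vjoin (vjoin (flat h) val) x \o rphi = vjoin x d.
    by apply/funext => -[].
  have E2 x : vjoin (vjoin (flat h) val) x \o rpsi = flat (replace h l x).
    by apply/funext => -[j i]; rewrite /= /rpsi /flat /replace /=; case: ifP.
  by split=> -[x] hx; exists x; move: hx; rewrite sat_And !sat_map E1 E2.
(* [u1] places the tuple along [e]. Indiscernibility over [d] allows moving it to [u2], whose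
   entries up to [l] lie left of the cut and whose later ones lie right of it; [g] descends, hence
   [k - p]. There [b] can take the place [l]. *)
pose u1 (p : 'I_k) : J1 + J2 := inl (f (s p)).
pose u2 (p : 'I_k) : J1 + J2 := if (p <= l)%N then inl (f p) else inr (g (k - p)%N).
have : sat Th (vjoin (flat (vjoin I1 I2 \o u1)) val).
  apply/(id k Th u1 u2).
  - by move=> p q /incs /fI.
  - move=> p q pq; rewrite /u2; case: leqP => pl; case: leqP => ql //=.
    + exact: fI.
    + by move: (leq_trans (ltn_trans pl pq) ql); rewrite ltnn.
    + by apply: gI; rewrite ltn_sub2l.
  apply/(ThE (vjoin I1 I2 \o u2)); exists b; split=> //.
  (* By indiscernibility of the sequence with [b] inserted, [psi] passes from [v1] to [v2], whose
     entry at [l] is [b]. *)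
  pose v1 (p : 'I_k) : (J1 + unit) + J2 := inl (inl (f (s p))).
  pose v2 (p : 'I_k) : (J1 + unit) + J2 := if (p < l)%N then inl (inl (f p))
    else if (p == l) then inl (inr tt) else inr (g (k - p)%N).
  have := ib k (formula_map inl psi) v1 v2.
  rewrite !sat_map => -[| |+ _].
  - by move=> p q /incs /fI.
  - move=> p q pq; rewrite /v2 -!(inj_eq val_inj) /=.
    case: (ltngtP p l) => pl; case: (ltngtP q l) => ql //=.
    + exact: fI.
    + by move: (ltn_trans (ltn_trans pl pq) ql); rewrite ltnn.
    + by apply: gI; rewrite ltn_sub2l.
    + by move: pq; rewrite ql ltnNge ltnW.
    + by move: (ltn_trans pq ql); rewrite pl ltnn.
    + by rewrite pl ql ltnn in pq.
  move=> /(_ psis).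
  set w := _ \o _; suff -> : w = flat (replace (vjoin I1 I2 \o u2) l b) by [].
  apply/funext => -[p q]; rewrite /w /flat /replace /= /v2 /u2.
  have [->|/eqP pl] := eqVneq p l; first by rewrite ltnn asboolT.
  rewrite asboolF//; case: ltngtP => // /val_inj; last by [].
by move=> /(ThE (vjoin I1 I2 \o u1)).
Qed.

End SmoothToCut.

(** * From the cut condition to smoothness *)

Section CutToSmooth.
Local Open Scope classical_set_scope.
Local Open Scope ring_scope.
Context {R : realType}.

(* Sets of the family have measure bounded away from 1, so they cannot exhaust
   [0, 1] up to measure 0; [x0] is the infimum of the points [x] such that they
   exhaust [x, 1]. *)
Lemma uncovered_gaps (Fam : set (set R)) (eps : R) : 0 < eps ->
  Fam set0 -> (forall F F', Fam F -> Fam F' -> Fam (F `|` F')) ->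
  (forall F, Fam F -> [/\ measurable F, F `<=` `[0, 1]%classic & len F <= 1 - eps]) ->
  exists x0, [/\ 0 < x0, x0 <= 1 & forall v, 0 <= v -> v < x0 ->
    exists u, [/\ v < u, u < x0 &
      forall F, Fam F -> ~ (`]v, u[%classic `<=` F)]].
Proof.
move=> eps0 Fam0 FamU FamP.
have mI F (x : R) : Fam F -> measurable (F `&` `[x, 1]%classic).
  by move=> /FamP[mF _ _]; apply: measurableI => //; exact: measurable_itv.
have sI F (x : R) : Fam F -> F `&` `[x, 1]%classic `<=` `[0, 1]%classic.
  by move=> /FamP[_ F01 _] y [/F01].
(* The points [x] for which members of the family cover [x, 1] up to arbitrarily small measure. *)
pose Nn : set R := [set x | 0 <= x <= 1 /\ forall eta : R, 0 < eta ->
  exists2 F, Fam F & 1 - x - eta < len (F `&` `[x, 1]%classic)].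
have Nn1 : Nn 1.
  split=> [|eta eta0]; first by rewrite ler01 lexx.
  exists set0 => //; rewrite subrr add0r (lt_le_trans _ (len_ge0 _))//.
  by rewrite oppr_lt0.
have lbN : lbound Nn 0 by move=> x [/andP[]].
have infN : has_inf Nn by split; [exists 1|exists 0].
pose x0 := inf Nn.
have x00 : 0 <= x0 by apply: lb_le_inf => //; exists 1.
have x0le x : Nn x -> x0 <= x by move=> Nx; apply: ge_inf => //; exists 0.
have x01 : x0 <= 1 by exact: x0le.
have Nx0 : Nn x0.
  split=> [|eta eta0]; first by rewrite x00.
  have [x Nx xlt] : exists2 x, Nn x & x < x0 + eta / 2.
    by apply: inf_adherent => //; rewrite divr_gt0.
  have eta2 : 0 < eta / 2 by lra.
  have [F FF lF] := Nx.2 _ eta2.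
  exists F => //; apply: (@lt_le_trans _ _ (len (F `&` `[x, 1]%classic))); first by lra.
  apply: le_len; [exact: mI|exact: mI|exact: sI|].
  move=> y [Fy]; rewrite /= in_itv /= => /andP[xy y1]; split=> //=.
  by rewrite in_itv /= y1 andbT (le_trans _ xy)// x0le.
exists x0; split=> //.
  rewrite lt_neqAle x00 andbT; apply/eqP => x0E.
  have [F FF lF] := Nx0.2 _ eps0; have [mF F01 lF'] := FamP _ FF.
  have : len (F `&` `[x0, 1]%classic) <= len F.
    by apply: le_len; [exact: mI|by []|by []|exact: subIsetl].
  by move: lF; rewrite -x0E; lra.
move=> v v0 vx0.
(* As [v] lies below the infimum [x0], every member of the family misses a fixed amount [eta] of
   [v, 1]. *)
have [eta [eta0 etaP]] : exists eta, 0 < eta /\ forall F, Fam F ->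
    len (F `&` `[v, 1]%classic) <= 1 - v - eta.
  apply: contrapT => nE; have : Nn v; last by move=> /x0le; rewrite leNgt vx0.
  split=> [|eta eta0]; first by rewrite v0 ltW// (lt_le_trans vx0).
  apply: contrapT => nF; apply: nE; exists eta; split=> // F FF.
  by rewrite leNgt; apply/negP => lF; apply: nF; exists F.
have eta3 : 0 < eta / 3 by lra.
have [F0 FF0 lF0] := Nx0.2 _ eta3.
(* [u] is within [eta / 3] of [x0], so covering the gap from [v] to [u], together with [x0, 1] up to
   [eta / 3], would miss less than [eta] of [v, 1]. The midpoint ensures [v < u]. *)
pose u := Num.max ((v + x0) / 2) (x0 - eta / 3).
have u1 : (v + x0) / 2 <= u by rewrite le_max lexx.
have u2 : x0 - eta / 3 <= u by rewrite le_max lexx orbT.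
have ux0 : u < x0 by rewrite gt_max; apply/andP; split; lra.
have vu : v < u by lra.
exists u; split=> // F FF vuF.
have FFF := FamU _ _ FF FF0.
have vuS : `]v, u[%classic `<=` `[0, 1]%classic.
  by move=> y /=; rewrite !in_itv /= => /andP[? ?]; apply/andP; split; lra.
have : len (`]v, u[%classic `|` (F0 `&` `[x0, 1]%classic)) <=
    len ((F `|` F0) `&` `[v, 1]%classic).
  apply: le_len.
  - by apply: measurableU; [exact: measurable_itv|exact: mI].
  - exact: mI.
  - exact: sI.
  - move=> y [yvu|[F0y yx0]]; split; [by left; exact: vuF| |by right|].
      by move: yvu; rewrite /= !in_itv /= => /andP[? ?]; apply/andP; split; lra.
    by move: yx0; rewrite /= !in_itv /= => /andP[? ?]; apply/andP; split; lra.
rewrite lenU; [|exact: measurable_itv|exact: mI|by []|exact: sI|]; last first.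
  apply/seteqP; split=> // y [/= + [_ /=]]; rewrite !in_itv /= => /andP[? ?] /andP[? ?].
  lra.
have := etaP _ FFF; rewrite (len_itv (ltW vu)); lra.
Qed.

Context {L : language} {kappa : Type} {C : structure L}.
Hypothesis kC : small kappa [set: set nat].
Hypothesis satC : saturated kappa C.

(** The formulas over [a] true throughout [G] are closed under conjunction, so by compactness the
    absence of a filler is due to a single one of them. *)
Lemma gap_filler_or_cover {n m} (a : unit_interval R -> tup C n)
    (d : tup C m) (phi : formula L ('I_n + 'I_m)) (G : set (unit_interval R)) :
  (exists c, sat phi (vjoin c d) /\ forall D : formula_over n (seq_set a),
    (forall i, G i -> holds D (a i)) -> holds D c) \/
  (exists D : formula_over n (seq_set a), (forall i, G i -> holds D (a i)) /\
    forall x, ~ (holds D x /\ sat phi (vjoin x d))).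
Proof.
have [cov|ncov] := pselect (exists D : formula_over n (seq_set a),
  (forall i, G i -> holds D (a i)) /\ forall x, ~ (holds D x /\ sat phi (vjoin x d))).
  by right.
left; pose A := seq_set a.
pose phi' : formula L ('I_n + (A + 'I_m)) := formula_map (vjoin inl (inr \o inr)) phi.
pose ren : 'I_n + A -> 'I_n + (A + 'I_m) := vjoin inl (inr \o inl).
pose q := vjoin (val : A -> C) d.
have phi'E x : sat phi' (vjoin x q) <-> sat phi (vjoin x d).
  by rewrite sat_map vjoin_comp.
have renE x (D : formula_over n A) : sat (formula_map ren D) (vjoin x q) <-> holds D x.
  by rewrite sat_map vjoin_comp.
pose Sigma : set (formula L ('I_n + (A + 'I_m))) := [set th |
  exists2 D : formula_over n A, (forall i, G i -> holds D (a i)) &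
    th = And phi' (formula_map ren D)].
have [||||_ [D aD ->]|c cP] := @compactness _ _ _ kC satC _ _ q Sigma.
- exact: le_continuum_count.
- apply: le_continuum_sum; last exact: le_continuum_count.
  apply: (@le_continuum_image _ _ (flat a)).
    by move=> x [j [i ->]]; exists (j, i).
  apply: le_continuum_prod; last exact: le_continuum_count.
  exact: le_continuum_inj val_inj (le_continuum_real R).
- by exists (And phi' (formula_map ren Top)), Top => // i _; rewrite /holds /=.
- move=> _ _ [D1 aD1 ->] [D2 aD2 ->].
  exists (And phi' (formula_map ren (And D1 D2))).
    by exists (And D1 D2) => // i Gi; apply/sat_And; split; [exact: aD1|exact: aD2].
  by move=> v; rewrite !(sat_And, sat_map); tauto.
- apply: contrapT => nx; apply: ncov; exists D; split=> // x [Dx phix].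
  by apply: nx; exists x; rewrite sat_And phi'E renE.
exists c; split=> [|D aD].
  have /sat_And[/phi'E//] : sat (And phi' (formula_map ren Top)) (vjoin c q).
  by apply: cP; exists Top => // i _; rewrite /holds /=.
have /sat_And[_ /renE//] : sat (And phi' (formula_map ren D)) (vjoin c q).
by apply: cP; exists D.
Qed.

Lemma keisler_le1 {n} {B : set C} (mu : formula_over n B -> R) :
  keisler_measure mu -> forall D, mu D <= 1.
Proof.
move=> [eqv ge0 top add] D; have := add D (Not D) (fun x h => h.2 h.1).
rewrite (eqv (Or D (Not D)) Top) ?top; last by move=> x; rewrite /holds /=; tauto.
by have := ge0 (Not D); lra.
Qed.

(** A formula over [a] inconsistent with [phi] has average measure at most [1 - mu (inst phi b)], so
    [uncovered_gaps] applies to the traces of such formulas. A gap contained in no such trace has a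
    filler, and iterating from 0 while staying below [x0] produces the sequence. *)
Lemma fillable_gap_sequence {n m} (a : unit_interval R -> tup C n)
    (B : set C) (AB : seq_set a `<=` B) (mu : formula_over n B -> R)
    (phi : formula L ('I_n + 'I_m)) (b : 'I_m -> B) :
  indiscernible (@lt_unit R) a set0 -> keisler_measure mu ->
  (forall D, mu (formula_incl AB D) = average_measure a D) ->
  0 < mu (inst phi b) ->
  exists v : nat -> unit_interval R, forall k, lt_unit (v k) (v k.+1) /\
    exists c, sat phi (vjoin c (val \o b)) /\
      forall D : formula_over n (seq_set a),
      (forall i, lt_unit (v k) i -> lt_unit i (v k.+1) -> holds D (a i)) -> holds D c.
Proof.
move=> ia muK muE eps0.
have [m0 [_ _ mA m1 mI]] := @ex_finitely_additive R.
pose Fam : set (set R) := [set F | exists2 D : formula_over n (seq_set a),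
  F = trace D & forall x, ~ (holds D x /\ sat phi (vjoin x (val \o b)))].
have [||F FF|x0 [x00 x01 gap]] := @uncovered_gaps Fam _ eps0.
- exists Bot; last by move=> x [].
  by apply/seteqP; split=> // x [].
- move=> _ _ [D -> Dphi] [D' -> D'phi]; exists (Or D D'); last first.
    move=> x [DD' phix]; apply: (D'phi x); split=> //; apply: DD' => Dx.
    by apply: (Dphi x).
  apply/seteqP; split=> [x [[i Di <-]|[i Di <-]]|_ [i Di <-]].
  + by exists i => // nD; case: nD.
  + by exists i => // _.
  + have [Da|nDa] := pselect (holds D (a i)); first by left; exists i.
    by right; exists i => //; exact: Di.
- case: FF => D -> Dphi.
  have [mD D01 _] := trace_regular D mA m1 mI ia.
  split=> //; have <- : mu (formula_incl AB D) = len (trace D) by exact: muE.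
  rewrite lerBrDr.
  rewrite -(keisler_add muK); first exact: keisler_le1.
  move=> x; rewrite /holds !sat_map !vjoin_comp => -[Dx phix].
  by apply: (Dphi x); split.
(* The condition [val i < x0] is kept inside the existential, so that a successor is available at
   every [i] for dependent choice. *)
have step (i : unit_interval R) : exists j : unit_interval R, val i < x0 ->
    [/\ val i < val j, val j < x0 &
    exists c, sat phi (vjoin c (val \o b)) /\
      forall D : formula_over n (seq_set a),
      (forall l, lt_unit i l -> lt_unit l j -> holds D (a l)) -> holds D c].
  have [ix0|nix0] := pselect (val i < x0); last by exists i.
  have := set_valP i; rewrite /= in_itv /= => /andP[i0 i1].
  have [u [iu ux0 uF]] := gap _ i0 ix0.
  have u01 : u \in `[0, 1]%classic by rewrite inE /= in_itv /=; apply/andP; split; lra.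
  pose j : unit_interval R := SigSub u01.
  exists j => _; split=> //.
  have [[c [cphi cD]]|[D [aD Dphi]]] := gap_filler_or_cover a (val \o b) phi
      [set l | lt_unit i l /\ lt_unit l j].
    by exists c; split=> // D aD; apply: cD => l [? ?]; exact: aD.
  exfalso; apply: (uF (trace D)); first by exists D.
  move=> y; rewrite /= in_itv /= => /andP[iy yu].
  have y01 : y \in `[0, 1]%classic by rewrite inE /= in_itv /=; apply/andP; split; lra.
  by exists (SigSub y01) => //; exact: aD.
have z01 : (0 : R) \in `[0, 1]%classic by rewrite inE /= in_itv /= lexx ler01.
pose z : unit_interval R := SigSub z01.
have [v [v0 vS]] := dependent_choice (fun i => cid (step i)) z.
have vx0 k : val (v k) < x0.
  by elim: k => [|k /vS[]//]; rewrite v0.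
by exists v => k; have [vk _ ck] := vS k (vx0 k).
Qed.

Lemma smooth_of_cut {n m} (a : unit_interval R -> tup C n)
    (B : set C) (AB : seq_set a `<=` B) (mu : formula_over n B -> R)
    (phi : formula L ('I_n + 'I_m)) (b : 'I_m -> B) :
  (forall (J1 J2 : Type) (lt1 : J1 -> J1 -> Prop) (lt2 : J2 -> J2 -> Prop)
      (I1 : J1 -> tup C n) (I2 : J2 -> tup C n) (d : tup C m) (b : tup C n),
    small kappa [set: J1 + J2] ->
    linear_order (lt_sum lt1 lt2) -> dense_order (lt_sum lt1 lt2) ->
    inhabited J1 -> inhabited J2 -> no_last lt1 -> no_first lt2 ->
    indiscernible (lt_sum lt1 lt2) (vjoin I1 I2) set0 ->
    indiscernible (lt_sum lt1 lt2) (vjoin I1 I2) (range d) ->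
    indiscernible (lt_sum (lt_sum lt1 lt_point) lt2)
      (vjoin (vjoin I1 (fun=> b)) I2) set0 ->
    divides phi d (seq_set (vjoin I1 I2)) ->
    ~ sat phi (vjoin b d)) ->
  indiscernible (@lt_unit R) a set0 -> keisler_measure mu ->
  (forall D, mu (formula_incl AB D) = average_measure a D) ->
  divides phi (val \o b) (seq_set a) -> mu (inst phi b) = 0.
Proof.
move=> cut ia muK muE [bs [ibs bs0 nbs]].
have : 0 <= mu (inst phi b) by exact: (keisler_ge0 muK).
rewrite le_eqVlt => /orP[/eqP//|eps0]; exfalso.
have [v vP] := fillable_gap_sequence ia muK muE eps0.
pose d := val \o b : tup C m.
have v_incr p q : (p < q)%N -> lt_unit (v p) (v q).
  elim: q => // q IH; rewrite ltnS leq_eqVlt => /orP[/eqP <-|/IH pq].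
    exact: (vP p).1.
  exact: lt_trans pq (vP q).1.
have v_le p q : (p <= q)%N -> val (v p) <= val (v q).
  by rewrite leq_eqVlt => /orP[/eqP ->//|/v_incr/ltW].
pose e := a \o v.
have ie : indiscernible (fun i j : nat => (i < j)%N) e set0.
  move=> k psi s t incs inct.
  by apply: (ia k psi (v \o s) (v \o t)) => p q; [move=> /incs|move=> /inct]; exact: v_incr.
have {}ibs : indiscernible (fun i j : nat => (i < j)%N) bs (seq_set e).
  by apply: indiscernible_sub ibs => _ [j [i ->]]; exists (v j), i.
(* The two copies of [rat] form a dense order with a cut, and the middle point is the one that fills
   it. *)
pose ltQ (x y : rat) : Prop := x < y.
pose J : Type := (rat + unit) + rat.
pose ltJ : J -> J -> Prop := lt_sum (lt_sum ltQ lt_point) ltQ.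
have ltJ_linear : linear_order ltJ.
  apply: lt_sum_linear lt_rat_linear.
  exact: lt_sum_linear lt_rat_linear lt_point_linear.
have cJ : le_continuum J by exact: (le_continuum_count J).
have [h [EM ih]] := stretching kC satC (flat bs) e ltJ_linear cJ
  (le_continuum_count (nat * 'I_m)%type).
have dbs : range d `<=` range (flat bs).
  by move=> _ [i _ <-]; exists (0%N, i) => //; rewrite /flat /= bs0.
pose mid : J := inl (inr tt).
have [c [cphi cD]] : exists c, sat phi (vjoin c d) /\
    forall D : formula L (J * 'I_n),
      sat D (flat h) <-> sat D (flat (replace h mid c)).
  apply: (EM_filler kC satC (d := d) (phi := phi) mid ltJ_linear cJ EM dbs ie).
  move=> k psi s l incs psis.
  (* The place [l] is taken by the filler of the gap from [v (s l)] to [v (s l).+1]. Later indices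
     of the tuple are at least [(s l).+1], so any [a i] from this gap keeps it increasing; hence
     [psi], read as a condition on the entry [l], holds throughout the gap and therefore at [c]. *)
  have [_ [c [cphi cD]]] := vP (s l).
  exists c; split=> //.
  pose ren (iq : 'I_k * 'I_n) : 'I_n + seq_set a :=
    if `[< iq.1 = l >] then inl iq.2 else inr (entry a (v (s iq.1)) iq.2).
  have renE x : holds (formula_map ren psi) x <-> sat psi (flat (replace (e \o s) l x)).
    rewrite /holds sat_map.
    suff -> : vjoin x val \o ren = flat (replace (e \o s) l x) by [].
    by apply/funext => -[i q]; rewrite /= /ren /flat /replace /=; case: ifP.
  apply/renE; apply: cD => i vi iv; apply/renE.
  have -> : replace (e \o s) l (a i) = a \o replace (v \o s) l i.
    by apply/funext => p; rewrite /replace /=; case: ifP.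
  have := ia k (formula_map inl psi) (v \o s) (replace (v \o s) l i).
  rewrite !sat_map => -[|p q pq|+ _].
  - by move=> p q /incs; exact: v_incr.
  - rewrite /replace; have [pl|pl] := pselect (p = l).
      rewrite asboolT// asboolF; last by move=> ql; rewrite pl ql ltnn in pq.
      apply: (lt_le_trans iv); apply: v_le.
      by rewrite -pl; exact: incs.
    rewrite asboolF//; have [ql|ql] := pselect (q = l).
      rewrite asboolT//; apply: le_lt_trans vi; apply: v_le.
      by rewrite -ql ltnW//; exact: incs.
    by rewrite asboolF//; apply: v_incr; exact: incs.
  by apply.
pose I1 := h \o inl \o inl; pose I2 := h \o inr.
pose emb (x : rat + rat) : J := match x with inl y => inl (inl y) | inr y => inr y end.
have hE : vjoin I1 I2 = h \o emb by apply/funext => -[].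
have i12 A : A `<=` range (flat bs) ->
    indiscernible (lt_sum ltQ ltQ) (vjoin I1 I2) A.
  move=> /ih ihA k psi s t incs inct.
  rewrite hE; apply: (ihA k psi (emb \o s) (emb \o t)) => p q.
    by move=> /incs /=; case: (s p) => ?; case: (s q).
  by move=> /inct /=; case: (t p) => ?; case: (t q).
apply: (cut rat rat ltQ ltQ I1 I2 d c) => //.
- apply: (@le_continuum_small _ _ _ _ id kC); last by move=> x _; exists x.
  exact: (le_continuum_count (rat + rat)%type).
- exact: lt_sum_linear lt_rat_linear lt_rat_linear.
- move=> [x|x] [y|y]; rewrite /= /ltQ // => xy.
  + by exists (inl ((x + y) / 2)); rewrite /= /ltQ; split; lra.
  + by exists (inl (x + 1)); rewrite /= /ltQ; split=> //; lra.
  + by exists (inr ((x + y) / 2)); rewrite /= /ltQ; split; lra.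
- by constructor; exact: 0.
- by constructor; exact: 0.
- by move=> x; exists (x + 1); rewrite /ltQ; lra.
- by move=> x; exists (x - 1); rewrite /ltQ; lra.
- exact: i12.
- exact: i12.
(* With the cut filled by [c], the sequence is [h] with its middle entry replaced, and it has the
   same type as the indiscernible [h]. *)
- have -> : vjoin (vjoin I1 (fun=> c)) I2 = replace h mid c.
    apply/funext => -[[x|[]]|x] /=; rewrite /replace.
    + by rewrite asboolF.
    + by rewrite asboolT.
    + by rewrite asboolF.
  by apply: indiscernible_same_type cD _; exact: ih.
- exists bs; split=> //.
  apply: (@indiscernible_sub _ _ _ _ _ _ _ (seq_set h)).
    by move=> _ [j [i ->]]; exists (emb j), i; rewrite hE.
  exact: (EM_dividing mid ltJ_linear EM ibs).
Qed.

End CutToSmooth.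

Theorem theorem3p14 (R : realType) (L : language) (T : theory L)
    (kappa : Type) (C : structure L)
    (hT : complete_theory T) (hC : monster kappa T C) (hNTP2 : NTP2 C) :
  NTP2_distal R kappa C <->
  (forall (n m : nat) (J1 J2 : Type)
      (lt1 : J1 -> J1 -> Prop) (lt2 : J2 -> J2 -> Prop)
      (I1 : J1 -> tup C n) (I2 : J2 -> tup C n)
      (d : tup C m) (b : tup C n)
      (phi : formula L ('I_n + 'I_m)),
    small kappa [set: J1 + J2]%classic ->
    linear_order (lt_sum lt1 lt2) ->
    dense_order (lt_sum lt1 lt2) ->
    inhabited J1 -> inhabited J2 ->
    no_last lt1 -> no_first lt2 ->
    indiscernible (lt_sum lt1 lt2) (vjoin I1 I2) set0 ->
    indiscernible (lt_sum lt1 lt2) (vjoin I1 I2) (range d) ->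
    indiscernible (lt_sum (lt_sum lt1 lt_point) lt2)
      (vjoin (vjoin I1 (fun=> b)) I2) set0 ->
    divides phi d (seq_set (vjoin I1 I2)) ->
    sat (Not phi) (vjoin b d)).
Proof.
have kC := monster_continuum hC; have satC := monster_saturated hC.
split=> [[_ smooth] n m J1 J2 lt1 lt2 I1 I2 d b phi _ lin _ iJ1 iJ2 nl nf _|cut].
  exact: (cut_of_smooth kC satC (smooth n)).
split=> // n a ia B AB mu _ muK muE m phi b.
apply: (smooth_of_cut kC satC _ ia muK muE) => J1 J2 lt1 lt2 I1 I2 d b'.
exact: cut.
Qed.
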